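(* Let $\Phi$ be a homogeneous Poisson point process on $\mathbb{R}^2$ with intensity $\lambda>0$, let $\boldsymbol{x}_{\rm s},\boldsymbol{x}_{\rm d}\in\mathbb{R}^2$ be at distance $2d$ with $d>0$, let $\mathsf{SNR}>0$, and let $G$ be a non-negative non-increasing path-loss function decaying to zero. Consider the threshold-based selective feedback distributed relay selection policy $\mathcal{P}_{\rm FB}$ with threshold value $T\ge d$, and let $\mathsf{R}_{\rm ave}(\mathcal{P}_{\rm FB},T)=\mathsf{E}[\mathsf{R}_{\Phi}(\mathcal{P}_{\rm FB},T)]$ be its average rate, where $\mathsf{R}_\Phi(\mathcal{P}_{\rm FB},T)$ is the fading-averaged rate given $\Phi$ defined in the context. Then $$\mathsf{R}_{\rm ave}(\mathcal{P}_{\rm FB},T)=\begin{cases}\displaystyle\frac12\int_d^T\log_2\left(1+\mathsf{SNR}\cdot G(\gamma)\right)f_{\Gamma_{\rm opt}}(\gamma)\,d\gamma & \text{if there is no fading},\\[2mm] \displaystyle\frac{1}{2\ln 2}\int_d^T e^{\frac{1}{\mathsf{SNR}\cdot G(\gamma)}}\,{\rm E}_1\left(\frac{1}{\mathsf{SNR}\cdot G(\gamma)}\right)f_{\Gamma_{\rm opt}}(\gamma)\,d\gamma & \text{if there is Rayleigh fading},\end{cases}$$ where $$f_{\Gamma_{\rm opt}}(\gamma)=4\lambda\gamma\operatorname{arcsec}\left(\frac{\gamma}{d}\right)\exp\left(-2\lambda d^2\left(\left(\frac{\gamma}{d}\right)^2\operatorname{arcsec}\left(\frac{\gamma}{d}\right)-\sqrt{\left(\frac{\gamma}{d}\right)^2-1}\right)\right)\mathbf{1}_{\{\gamma\ge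 d\}}.$$
   Context: $\boldsymbol{x}_{\rm s}$, $\boldsymbol{x}_{\rm d}$ are the source and destination locations; the points of $\Phi$ are relay locations. Let $\widehat{s}(\boldsymbol{x})=\max\{\|\boldsymbol{x}_{\rm s}-\boldsymbol{x}\|,\|\boldsymbol{x}-\boldsymbol{x}_{\rm d}\|\}$. Path loss: $G:(0,\infty)\to[0,\infty)$ is non-increasing with $G(x)\to 0$ as $x\to\infty$. Fading: $H_{\rm s,r}$ and $H_{\rm r,d}$ are identically distributed complex random variables (source–relay and relay–destination fading coefficients), independent of $\Phi$. ''No fading'' means $|H|^2=1$ deterministically. ''Rayleigh fading'' means $H\sim\mathcal{CN}(0,1)$, i.e. $|H|^2$ is exponential with unit mean. Rate of a selected relay: if the relay at $\boldsymbol{X}\in\Phi$ is selected, the rate given $\Phi$, averaged over fading only, is $$\frac12\min\left\{\mathsf{E}\left[\log_2(1+\mathsf{SNR}|H_{\rm s,r}|^2G(\|\boldsymbol{x}_{\rm s}-\boldsymbol{X}\|))\,\big|\,\Phi\right],\ \mathsf{E}\left[\log_2(1+\mathsf{SNR}|H_{\rm r,d}|^2G(\|\boldsymbol{X}-\boldsymbol{x}_{\rm d}\|))\,\big|\,\Phi\right]\right\}.$$ Policy $\mathcal{P}_{\rm FB}$ with threshold $T$: a relay at $\boldsymbol{X}\in\Phi$ feeds back $\widehat{s}(\boldsymbol{X})$ to the source if and only if $\widehat{s}(\boldsymbol{X})\le T$. If at least one relay feeds back, the source selects, among those feeding back, a relay minimizing $\widehat{s}$, and, writing $\boldsymbol{X}^\star$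 for the location of that relay, $$\mathsf{R}_\Phi(\mathcal{P}_{\rm FB},T)=\frac12\min\left\{\mathsf{E}\left[\log_2(1+\mathsf{SNR}|H_{\rm s,r}|^2G(\|\boldsymbol{x}_{\rm s}-\boldsymbol{X}^\star\|))\,\big|\,\Phi\right],\ \mathsf{E}\left[\log_2(1+\mathsf{SNR}|H_{\rm r,d}|^2G(\|\boldsymbol{X}^\star-\boldsymbol{x}_{\rm d}\|))\,\big|\,\Phi\right]\right\}.$$ If no relay feeds back, the source does not transmit and $\mathsf{R}_\Phi(\mathcal{P}_{\rm FB},T)=0$. Notation: ${\rm E}_1(x)=\int_1^\infty\frac{e^{-tx}}{t}\,dt$ for $x>0$; $e^{1/u}{\rm E}_1(1/u)$ is read as its limit $0$ when $u=0$. $\operatorname{arcsec}(u)=\arccos(1/u)$ for $u\ge1$. ($f_{\Gamma_{\rm opt}}$ is the density of $\Gamma_{\rm opt}=\min_{\boldsymbol{X}\in\Phi}\widehat{s}(\boldsymbol{X})$.) *)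

(* Defs.v *)
From HB Require Import structures.
From mathcomp Require Import all_boot all_order all_algebra.
From mathcomp Require Import complex.
From mathcomp Require Import all_classical all_reals all_analysis.
From mathcomp Require Import measurable_realfun.
Set Implicit Arguments.
Unset Strict Implicit.
Unset Printing Implicit Defensive.
Import Order.TTheory GRing.Theory Num.Theory.
Import numFieldNormedType.Exports.
Local Open Scope classical_set_scope.
Local Open Scope ring_scope.

Section geometry.
Context {R : realType}.
Implicit Types x y xs xd : R * R.

(* The library norm on R * R is the sup norm. *)
Definition eucl_dist x y : R :=
  Num.sqrt ((x.1 - y.1) ^+ 2 + (x.2 - y.2) ^+ 2).

Definition area : set (R * R) -> \bar R :=
  (lebesgue_measure \x lebesgue_measure)%E.

Definition shat xs xd x : R := Num.max (eucl_dist xs x) (eucl_dist x xd).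

End geometry.

Section special_functions.
Context {R : realType}.
Implicit Types x u d lambda gamma : R.

Definition log2 x : R := ln x / ln 2.

Definition arcsec u : R := acos u^-1.

Definition E1 x : R :=
  (\int[lebesgue_measure]_(t in `[1%R, +oo[) (expR (- (t * x)) / t))%R.

(* e^(1/u) E1(1/u), with its limit value at u = 0. *)
Definition expE1 u : R := if u == 0 then 0 else expR u^-1 * E1 u^-1.

Definition f_Gamma_opt lambda d gamma : R :=
  4 * lambda * gamma * arcsec (gamma / d) *
  expR (- (2 * lambda * d ^+ 2 *
           ((gamma / d) ^+ 2 * arcsec (gamma / d) -
            Num.sqrt ((gamma / d) ^+ 2 - 1)))) *
  \1_(`[d, +oo[) gamma.

(* Only the values of G on (0, +oo) are constrained. *)
Definition path_loss (G : R -> R) : Prop :=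
  [/\ forall x, 0 < x -> 0 <= G x,
      forall x y, 0 < x -> x <= y -> G y <= G x
    & G x @[x --> +oo] --> (0 : R)].

End special_functions.

Section probability_notions.
Context {dsp : measure_display} {Omega : measurableType dsp} {R : realType}.
Variable P : probability Omega R.
Implicit Types (F : set (set Omega)) (D : set Omega).

(* The choice B i = setT gives the product rule for the subfamilies. *)
Definition mutually_independent n (X : 'I_n -> Omega -> \bar R) : Prop :=
  forall B : 'I_n -> set (\bar R), (forall i, measurable (B i)) ->
    P (\bigcap_i (X i @^-1` B i)) = (\prod_(i < n) P (X i @^-1` B i))%E.

(* [Y] is a version, on the event [D] of the sub-sigma-algebra [F], of the
   conditional expectation given [F] of an almost surely nonnegative [Z] that
   is only meaningful on [D]. Infinite values are allowed, so that no
   integrability of [Z] is needed. *)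
Definition cond_exp_on F D (Z Y : Omega -> \bar R) : Prop :=
  preimage_set_system D Y measurable `<=` F /\
  forall A, F A -> A `<=` D ->
    (\int[P]_(w in A) Y w = \int[P]_(w in A) Z w)%E.

Definition C_pair (z : R[i]) : R * R := (complex.Re z, complex.Im z).

Definition complex_RV (H : Omega -> R[i]) : Prop :=
  measurable_fun [set: Omega] (C_pair \o H).

Definition complex_law (H : Omega -> R[i]) : set (R * R) -> \bar R :=
  pushforward P (C_pair \o H).

Definition identically_distributed (H H' : Omega -> R[i]) : Prop :=
  forall B, measurable B -> complex_law H B = complex_law H' B.

Definition independent_of F (H : Omega -> R[i]) : Prop :=
  forall A B, F A -> measurable B ->
    P (A `&` (C_pair \o H) @^-1` B) = (P A * P ((C_pair \o H) @^-1` B))%E.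

Definition no_fading (H : Omega -> R[i]) : Prop :=
  {ae P, forall w, Normc.normc (H w) ^+ 2 = 1}.

(* CN(0,1): the real and imaginary parts are independent N(0, 1/2);
   the second argument of [normal_prob] is the standard deviation. *)
Definition Rayleigh_fading (H : Omega -> R[i]) : Prop :=
  let N := normal_prob 0 (Num.sqrt 2^-1) in
  forall B, measurable B -> complex_law H B = (N \x N)%E B.

End probability_notions.

Section point_processes.
Context {dsp : measure_display} {Omega : measurableType dsp} {R : realType}.
Implicit Type Phi : Omega -> set (R * R).

Definition pp_count Phi (A : set (R * R)) (w : Omega) : \bar R :=
  counting (Phi w `&` A).

Definition pp_sigma Phi : set (set Omega) :=
  <<s \bigcup_(A in measurable)
        preimage_set_system setT (pp_count Phi A) measurable >>.

(* A (simple) point process, seen as a random locally finite set. *)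
Definition point_process Phi : Prop :=
  (forall w (B : set (R * R)), bounded_set B -> finite_set (Phi w `&` B)) /\
  (forall A, measurable A -> measurable_fun [set: Omega] (pp_count Phi A)).

(* The second argument of [poisson_prob] is a dummy. *)
Definition homogeneous_PPP (P : probability Omega R) (lambda : R) Phi : Prop :=
  [/\ point_process Phi,
      forall A : set (R * R), measurable A -> bounded_set A ->
        forall k : nat, P (pp_count Phi A @^-1` [set k%:R%:E]) =
          poisson_prob (lambda * fine (area A)) 0 [set k]
    & forall n (A : 'I_n -> set (R * R)),
        (forall i, measurable (A i)) -> (forall i, bounded_set (A i)) ->
        trivIset setT A -> mutually_independent P (fun i => pp_count Phi (A i))].

End point_processes.

Section relay_selection.
Context {dsp : measure_display} {Omega : measurableType dsp} {R : realType}.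
Variables (Phi : Omega -> set (R * R)) (xs xd : R * R).

(* The minimum of [shat] over the relays; it is attained as soon as there is a
   relay, and is the junk value 0 on the null event that there is none. *)
Definition Gamma_opt (w : Omega) : R := inf (shat xs xd @` Phi w).

Definition feedback (T : R) (w : Omega) : set (R * R) :=
  [set X | Phi w X /\ shat xs xd X <= T].

Definition feedback_event (T : R) : set Omega :=
  [set w | feedback T w !=set0].

(* On the event that some relay feeds back, [Xstar] is a random location
   determined by [Phi], with any rule to break ties. *)
Definition selected_relay (T : R) (Xstar : Omega -> R * R) : Prop :=
  preimage_set_system (feedback_event T) Xstar measurable `<=` pp_sigma Phi /\
  forall w, feedback_event T w ->
    feedback T w (Xstar w) /\
    forall X, feedback T w X -> shat xs xd (Xstar w) <= shat xs xd X.

End relay_selection.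

Section rates.
Context {dsp : measure_display} {Omega : measurableType dsp} {R : realType}.

Definition link_rate (SNR : R) (G : R -> R) (H : Omega -> R[i])
    (dist : Omega -> R) (w : Omega) : \bar R :=
  (log2 (1 + SNR * Normc.normc (H w) ^+ 2 * G (dist w)))%:E.

(* The fading-averaged rate given the relays: [Csr] and [Crd] are the
   conditional expectations of the rates of the two links of the selected
   relay, and the rate is 0 when no relay feeds back. *)
Definition rate_FB (P : probability Omega R) (Phi : Omega -> set (R * R))
    (xs xd : R * R) (T SNR : R) (G : R -> R) (Hsr Hrd : Omega -> R[i])
    (RPhi : Omega -> \bar R) : Prop :=
  let fb := feedback_event Phi xs xd T in
  exists Xstar Csr Crd, [/\ selected_relay Phi xs xd T Xstar,
    cond_exp_on P (pp_sigma Phi) fb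
      (link_rate SNR G Hsr (fun w => eucl_dist xs (Xstar w))) Csr,
    cond_exp_on P (pp_sigma Phi) fb
      (link_rate SNR G Hrd (fun w => eucl_dist (Xstar w) xd)) Crd
  & RPhi = (fun w => (2^-1)%:E * Order.min (Csr w) (Crd w))%E \_ fb].

End rates.

(* Main.v *)
(** The number of relays in a region is Poisson, so [Gamma_opt > r] has
    probability [exp (- lambda * area)], where the area is that of the lens of
    points at distance at most [r] from both [xs] and [xd]; a rotation (a product
    of three shears) brings the lens to an axis, where Cavalieri's principle
    computes its area. Differentiating gives the density. Since the fading is
    independent of the relays, the conditional expected rate of a link of length
    [s] is [psi (G s)], with [psi] the mean rate under the fading law; as
    [psi \o G] is nonincreasing, the minimum over the two links is
    [psi (G Gamma_opt)], and its expectation is an integral against the density.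
    For Rayleigh fading, the squared modulus is exponential because the squared
    norm maps the area to [pi] times the Lebesgue measure of [0, +oo[. *)
Require Import Defs.
From HB Require Import structures.
From mathcomp Require Import all_boot all_order all_algebra.
From mathcomp Require Import complex.
From mathcomp Require Import all_classical all_reals all_analysis.
From mathcomp Require Import measurable_realfun.
From mathcomp Require Import ring lra.
Set Implicit Arguments.
Unset Strict Implicit.
Unset Printing Implicit Defensive.
Import Order.TTheory GRing.Theory Num.Theory.
Import numFieldNormedType.Exports HBNNSimple.
Local Open Scope classical_set_scope.
Local Open Scope ring_scope.

(** * Measures with a density *)

(** The conditional expectations are known only as versions, and [G] is constrained on positive
    arguments alone and may blow up at 0, so the rate of a link may fail to be integrable. Versions
    are therefore identified almost surely on events where the mean rate is bounded, after
    discarding the null event that a relay sits at [xs] or [xd]. The minimum is taken after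
    averaging, so each link is treated separately. The mean rate [psi] and a scale [c] stay abstract
    until the end: [c = 1] and [c = ln 2] give the constants 1/2 and 1 / (2 ln 2). The factor
    [4 lambda gamma arcsec (gamma / d)] of the density is [lambda] times the perimeter of the lens,
    which is the derivative of its area. Without relays [Gamma_opt] takes the default 0, which lies
    below [d]; that event is null because arbitrarily large rectangles would have to be empty. *)

Lemma ge0_integral_density d (T : measurableType d) (R : realType)
    (mu nu : {measure set T -> \bar R}) (f : T -> R) :
  measurable_fun setT f -> (forall x, 0 <= f x) ->
  (forall A, measurable A -> nu A = \int[mu]_(x in A) (f x)%:E)%E ->
  forall g : T -> \bar R, measurable_fun setT g -> (forall x, 0 <= g x)%E ->
  (\int[nu]_x g x = \int[mu]_x (g x * (f x)%:E))%E.
Proof.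
move=> mf f0 nuE g mg g0.
have mfE : measurable_fun setT (EFin \o f) by exact/measurable_EFinP.
pose g_ := nnsfun_approx measurableT mg.
(* The claim for simple functions follows by linearity from the hypothesis on sets; monotone
   convergence along [nnsfun_approx] then gives the general case. *)
have nnsfunE (h : {nnsfun T >-> R}) :
    (\int[nu]_x (h x)%:E = \int[mu]_x ((h x)%:E * (f x)%:E))%E.
  under eq_integral do rewrite fimfunE -fsumEFin//.
  rewrite ge0_integral_fsum//; last 2 first.
    by move=> r; exact/measurable_EFinP/measurableT_comp.
    by move=> n x _; rewrite EFinM nnfun_muleindic_ge0.
  under [RHS]eq_integral.
    move=> x _; rewrite fimfunE -fsumEFin// muleC ge0_mule_fsumr; last first.
      by move=> r; rewrite EFinM nnfun_muleindic_ge0.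
    over.
  rewrite [RHS]ge0_integral_fsum//; last 2 first.
    move=> r; apply: emeasurable_funM => //.
    by apply/measurable_EFinP; apply/measurableT_comp.
    by move=> n x _; rewrite mule_ge0 ?lee_fin// -lee_fin EFinM
      nnfun_muleindic_ge0.
  apply: eq_fsbigr => r _; rewrite integralZl_indic_nnsfun//=.
  under [RHS]eq_integral do rewrite EFinM muleCA.
  (* The sum is indexed by all reals [r]. A negative one has an empty preimage; only a nonnegative
     one may be pulled out of the integral. *)
  have [r0|r0] := leP 0 r; last first.
    have -> : h @^-1` [set r] = set0 by exact: preimage_nnfun0.
    rewrite integral_indic// set0I measure0 mule0.
    by under eq_integral do rewrite indicE in_set0 mule0 mule0; rewrite integral0.
  rewrite ge0_integralZl//; last 2 first.
    by apply: emeasurable_funM => //; exact/measurable_EFinP.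
    by move=> x _; rewrite mule_ge0// lee_fin.
  congr (_ * _)%E; rewrite integral_indic// setIT nuE//.
  rewrite [LHS]integral_mkcond; apply: eq_integral => x _.
  rewrite patchE indicE; case: ifPn => _; by rewrite ?mule1 ?mule0.
transitivity (lim (\int[nu]_x (g_ n x)%:E @[n --> \oo]))%E.
  rewrite -monotone_convergence//=.
  - apply: eq_integral => x _; apply/esym/cvg_lim => //=.
    exact: cvg_nnsfun_approx.
  - by move=> n; exact/measurable_EFinP.
  - by move=> n x _; rewrite lee_fin.
  - by move=> x _ m n mn; rewrite lee_fin; exact/lefP/nd_nnsfun_approx.
under eq_fun do rewrite nnsfunE.
rewrite -monotone_convergence//=.
- apply: eq_integral => x _; apply/cvg_lim => //=.
  apply: cvgeZr => //; exact: cvg_nnsfun_approx.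
- by move=> n; apply: emeasurable_funM => //; exact/measurable_EFinP.
- by move=> n x _; rewrite mule_ge0// lee_fin.
- move=> x _ m n mn; apply: lee_wpmul2r; first by rewrite lee_fin.
  by rewrite lee_fin; exact/lefP/nd_nnsfun_approx.
Qed.

(** Uniqueness of measures: the intervals []a, b]] are stable under intersection, generate the Borel
    sets, and the []-n, n]] cover the line with finite measure. *)
Lemma eq_measure_ocitv (R : realType)
    (m1 m2 : {measure set (measurableTypeR R) -> \bar R}) :
  (forall a b : R, a < b -> m1 `]a, b]%classic = m2 `]a, b]%classic) ->
  (forall a b : R, m1 `]a, b]%classic < +oo)%E ->
  forall A, measurable A -> m1 A = m2 A.
Proof.
move=> m12 m1oo A mA.
apply: (@measure_unique _ R (measurableTypeR R) (@ocitv R)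
  (fun n : nat => `](- n%:R : R), n%:R]%classic)) => //.
- exact: ocitvI.
- by move=> n; exists (- n%:R, n%:R).
- rewrite -subTset => x _ /=; exists (Num.truncn `|x|).+1 => //=.
  have := truncnS_gt `|x|; rewrite in_itv/= => xn.
  by have := ltr_normlW xn; have := ltrNnormlW xn; lra.
- move=> _ [[a b] _ <-] /=.
  have [ab|ba] := ltP a b; first exact: m12.
  by rewrite set_itv_ge ?measure0// bnd_simp -leNgt.
Qed.

(** The integral of [f] over a set is itself a measure in that set, so uniqueness applies. This
    serves both for the law of [Gamma_opt] and for the image of the area under the squared norm. *)
Lemma measure_density_ocitv (R : realType)
  (m : {measure set (measurableTypeR R) -> \bar R})
    (f : R -> R) : measurable_fun setT f -> (forall x, 0 <= f x) ->
  (forall a b : R, (a < b)%R ->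
    m `]a, b]%classic = \int[lebesgue_measure]_(x in `]a, b]) (f x)%:E)%E ->
  (forall a b : R, m `]a, b]%classic < +oo)%E ->
  forall B, measurable B -> (m B = \int[lebesgue_measure]_(x in B) (f x)%:E)%E.
Proof.
move=> mf f0 mE moo.
pose nu (B : set (measurableTypeR R)) :=
  (\int[lebesgue_measure]_(x in B) (f x)%:E)%E.
have nu0 : nu set0 = 0%E by rewrite /nu integral_set0.
have nu_ge0 B : (0 <= nu B)%E by apply: integral_ge0 => x _; rewrite lee_fin.
have nuD : semi_sigma_additive nu.
  by apply: semi_sigma_additive_nng_induced => //; exact/measurable_EFinP.
pose nu' : {measure set (measurableTypeR R) -> \bar R} :=
  HB.pack nu (isMeasure.Build _ _ _ nu nu0 nu_ge0 nuD).
exact: (@eq_measure_ocitv R m nu' mE moo).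
Qed.

(** * Area of a lens *)

Lemma lebesgue_measure_shift (R : realType) (a : R) (A : set R) : measurable A ->
  lebesgue_measure ((fun y => y + a) @^-1` A) = lebesgue_measure A.
Proof.
move=> mA.
have mphi : measurable_fun setT
  (fun y : measurableTypeR R => (y + a : measurableTypeR R)).
  by apply: measurable_funD.
pose phi : {mfun _ >-> _} :=
  HB.pack (fun y : measurableTypeR R => (y + a : measurableTypeR R))
  (isMeasurableFun.Build _ _ _ _ _ mphi).
apply/esym.
apply: (lebesgue_measure_unique (mu := pushforward lebesgue_measure phi)) =>
  // _ [[x y]] _ <-.
transitivity (lebesgue_measure `]x - a, y - a]%classic); last first.
  congr (lebesgue_measure _).
  by apply/seteqP; split=> z /=; rewrite !in_itv/= ltrBlDr lerBrDr.
rewrite !lebesgue_measure_itv/= !lte_fin ltrD2r; case: ifPn => // _.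
by congr (_%:E); ring.
Qed.

(** * Invariance of the area under shears and rotations *)

Section shears.
Context {R : realType}.
Implicit Types (A : set (R * R)) (f : R -> R).

Lemma measurable_shearl f : measurable_fun setT f ->
  measurable_fun setT (fun p : R * R => (p.1 + f p.2, p.2)).
Proof.
move=> mf; apply/measurable_fun_pairP; split => /=.
  by apply: measurable_funD => //; exact: measurableT_comp.
exact: measurable_snd.
Qed.

Lemma measurable_shearr f : measurable_fun setT f ->
  measurable_fun setT (fun p : R * R => (p.1, p.2 + f p.1)).
Proof.
move=> mf; apply/measurable_fun_pairP; split => /=.
  exact: measurable_fst.
by apply: measurable_funD => //; exact: measurableT_comp.
Qed.

(** Each vertical section is translated by the constant [f x], and [area] integrates the lengths of
    vertical sections. *)
Lemma area_shearr f A : measurable_fun setT f -> measurable A ->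
  area ((fun p => (p.1, p.2 + f p.1)) @^-1` A) = area A.
Proof.
move=> mf mA; apply: eq_integral => x _ /=.
rewrite -[RHS](lebesgue_measure_shift (f x)); last exact: measurable_xsection.
congr (lebesgue_measure _); apply/seteqP; split => y;
  rewrite /= /xsection/= !inE; by [].
Qed.

(** The horizontal sections are now the translated ones, so [area] is first rewritten as the product
    measure taken in the other order. *)
Lemma area_shearl f A : measurable_fun setT f -> measurable A ->
  area ((fun p => (p.1 + f p.2, p.2)) @^-1` A) = area A.
Proof.
move=> mf mA.
have areaE B : measurable B ->
  area B = (lebesgue_measure \x^ lebesgue_measure)%E B.
  move=> mB; apply: product_measure_unique => // *; exact: product_measure2E.
rewrite !areaE//; last first.
  by rewrite -[X in measurable X]setTI; exact: measurable_shearl.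
apply: eq_integral => y _ /=.
rewrite -[RHS](lebesgue_measure_shift (f y)); last exact: measurable_ysection.
congr (lebesgue_measure _); apply/seteqP; split => x;
  rewrite /= /ysection/= !inE; by [].
Qed.

(* A rotation is a product of three shears, of parameters [- tan (theta / 2)],
   [sin theta], [- tan (theta / 2)], where [tan (theta / 2) = s / (1 + c)]. *)
Lemma area_rotation (c s : R) A : c ^+ 2 + s ^+ 2 = 1 -> c != -1 ->
  measurable A ->
  area ((fun p => (c * p.1 - s * p.2, s * p.1 + c * p.2)) @^-1` A) = area A.
Proof.
move=> cs1 c1 mA; pose t := s / (1 + c).
have c10 : 1 + c != 0 by rewrite addrC addr_eq0.
have mM k : measurable_fun setT (fun y : R => k * y) by exact: measurable_funM.
rewrite -(area_shearl (mM (- t)) mA).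
have mA1 : measurable ((fun p : R * R => (p.1 + - t * p.2, p.2)) @^-1` A).
  by rewrite -[X in measurable X]setTI; exact: measurable_shearl.
rewrite -(area_shearr (mM s) mA1).
set A1 := _ @^-1` A in mA1 *.
have mA2 : measurable ((fun p : R * R => (p.1, p.2 + s * p.1)) @^-1` A1).
  by rewrite -[X in measurable X]setTI; exact: measurable_shearr.
rewrite -(area_shearl (mM (- t)) mA2).
congr (area _); apply/funext => -[x y]; rewrite /A1 /= /t.
(* Half-angle identities [t s = 1 - c] and [t c = s - t], both consequences of [c ^+ 2 + s ^+ 2 = 1]
   or of the definition of [t]; they turn the product of the shears into the rotation. *)
have ts : s / (1 + c) * s = 1 - c.
  by apply: (mulIf c10); rewrite mulrAC divfK// -expr2 -[s ^+ 2](addrK (c ^+ 2))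
    (addrC (s ^+ 2)) cs1; ring.
have tc : s / (1 + c) * c = s - s / (1 + c).
  by apply: (mulIf c10); rewrite mulrAC divfK// mulrBl divfK//; ring.
congr (A (_, _)).
  transitivity ((1 - s / (1 + c) * s) * x -
    (2 * (s / (1 + c)) - s / (1 + c) * (s / (1 + c) * s)) * y); last by ring.
  by rewrite ts mulrBr tc; ring.
transitivity (s * x + (1 - s / (1 + c) * s) * y); last by ring.
by rewrite ts; ring.
Qed.

End shears.

(** Meant for [acos], whose continuity holds within [[-1, 1]]: the primitive of the half chord and
    the density both reach the argument 1, at [x = r - d] and at [gamma = d]. *)
Lemma within_continuous_comp (T U V : topologicalType) (A : set T) (B : set U)
    (h : T -> U) (g : U -> V) : {within A, continuous h} ->
  (forall x, A x -> B (h x)) -> {within B, continuous g} ->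
  {within A, continuous (g \o h)}.
Proof.
move=> /subspace_continuousP ch AB /subspace_continuousP cg.
apply/subspace_continuousP => x Ax.
apply: (@cvg_comp _ _ _ h g _ (within B (nbhs (h x)))); last exact: cg (AB _ Ax).
move=> P wP.
have chx : nbhs x (fun y => A y -> B (h y) -> P (h y)) := ch _ Ax _ wP.
change (nbhs x (fun y => A y -> P (h y))).
by apply: filterS chx => y hP Ay; exact: hP Ay (AB _ Ay).
Qed.

Lemma within_continuous_acos (R : realType) :
  {within `[-1, 1]%classic, continuous (@acos R)}.
Proof.
have := @segment_can_ge_continuous R 0 pi (@cos R) (@acos R).
rewrite cos0 cospi; apply; first exact: pi_ge0.
- exact/continuous_subspaceT/continuous_cos.
- by move=> x xp; rewrite cosK.
Qed.

Section lens.
Context {R : realType}.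
Implicit Types d r x : R.

(* The points at distance at most [r] from both [(- d, 0)] and [(d, 0)]. *)
Definition lens d r : set (R * R) :=
  [set p | (`|p.1| + d) ^+ 2 + p.2 ^+ 2 <= r ^+ 2].

Lemma measurable_lens d r : measurable (lens d r).
Proof.
rewrite -[lens d r]setTI; apply: measurable_fun_le => //.
apply: measurable_funD; apply: measurable_funX; last exact: measurable_snd.
by apply: measurable_funD => //; apply: measurableT_comp => //;
  exact: measurable_fst.
Qed.

(** One formula covers all [x]: when the vertical line misses the lens the radicand is negative and
    [Num.sqrt] returns 0. *)
Lemma lebesgue_measure_xsection_lens d r x :
  lebesgue_measure (xsection (lens d r) x) =
  (2 * Num.sqrt (r ^+ 2 - (`|x| + d) ^+ 2))%:E.
Proof.
have [le0|gt0] := ltP (r ^+ 2 - (`|x| + d) ^+ 2) 0.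
  rewrite ltr0_sqrtr// mulr0 (_ : xsection _ _ = set0) ?measure0//.
  apply/seteqP; split => // y; rewrite /xsection/= inE /lens/= => h.
  by have := sqr_ge0 y; move: le0 h; lra.
set h := Num.sqrt _.
have -> : xsection (lens d r) x = `[- h, h]%classic.
  apply/seteqP; split => y; rewrite /xsection /= inE /lens /= in_itv/= -ler_norml.
    move=> H; rewrite -(ler_pXn2r (n := 2)) ?nnegrE ?sqrtr_ge0//.
    by rewrite sqr_sqrtr// real_normK ?num_real//; lra.
  rewrite -(ler_pXn2r (n := 2)) ?nnegrE ?sqrtr_ge0//.
  by rewrite sqr_sqrtr// real_normK ?num_real//; lra.
rewrite lebesgue_measure_itv/= lte_fin; have :=
  sqrtr_ge0 (r ^+ 2 - (`|x| + d) ^+ 2).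
rewrite -/h le_eqVlt => /predU1P[<-|h0]; first by rewrite oppr0 ltxx mulr0.
by rewrite ifT; [congr (_%:E); ring|lra].
Qed.

(** The primitive is, up to a constant, the area under the circle of radius [r]: a triangle,
    [(x + d) sqrt(...) / 2], and a circular sector, the arccosine term. *)
Lemma is_derive_half_chord d r x : 0 < r -> - r < x + d < r ->
  is_derive x 1
    (fun x => ((x + d) * Num.sqrt (r ^+ 2 - (x + d) ^+ 2) -
      r ^+ 2 * acos ((x + d) / r)) / 2)
    (Num.sqrt (r ^+ 2 - (x + d) ^+ 2)).
Proof.
move=> r0 xdr.
have h1 : 0 < r ^+ 2 - (x + d) ^+ 2 by nra.
have h2 : -1 < (x + d) / r < 1 by rewrite ltr_pdivlMr// ltr_pdivrMr//; lra.
have ds := is_derive1_sqrt h1.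
have da := is_derive1_acos h2.
have dh : is_derive x 1 (fun x => x + d) 1 by apply: is_derive_eq; rewrite addr0.
have dq : is_derive x 1 (fun x => r ^+ 2 - (x + d) ^+ 2) (- (2 * (x + d))).
  by apply: is_derive_eq; rewrite /GRing.scale /=; ring.
have dhr : is_derive x 1 (fun x => (x + d) / r) r^-1.
  by apply: is_derive_eq; rewrite /GRing.scale /=; ring.
have d1 := is_derive1_comp (f := Num.sqrt) (g := fun x => r ^+ 2 - (x + d) ^+ 2)
  ds dq.
have d2 := is_derive1_comp (f := @acos R) (g := fun x => (x + d) / r) da dhr.
(* The differentiation rules are applied to abstract [f1] and [f2], so that the square root and the
   arccosine enter only through their derivatives. *)
have comb (f1 f2 : R -> R) a b : is_derive x 1 f1 a -> is_derive x 1 f2 b ->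
    is_derive x 1 (fun x => ((x + d) * f1 x - r ^+ 2 * f2 x) / 2)
      (((x + d) * a + f1 x - r ^+ 2 * b) / 2).
  by move=> ? ?; apply: is_derive_eq; rewrite /GRing.scale /=; field.
apply: (is_derive_eq (comb _ _ _ _ d1 d2)) => /=.
set s := Num.sqrt (r ^+ 2 - _).
have s0 : 0 < s by rewrite sqrtr_gt0.
have -> : Num.sqrt (1 - ((x + d) / r) ^+ 2) = s / r.
  rewrite (_ : 1 - _ = (r ^+ 2 - (x + d) ^+ 2) / r ^+ 2); last by field;
    rewrite gt_eqF.
  by rewrite sqrtrM ?ltW// sqrtrV ?sqr_ge0// sqrtr_sqr gtr0_norm.
have s2 : s ^+ 2 = r ^+ 2 - (x + d) ^+ 2 by rewrite sqr_sqrtr// ltW.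
have -> : r ^+ 2 = s ^+ 2 + (x + d) ^+ 2 by rewrite s2; ring.
field.
by rewrite !gt_eqF.
Qed.

Lemma continuous_half_chord d r :
  continuous (fun x => Num.sqrt (r ^+ 2 - (x + d) ^+ 2)).
Proof.
move=> x; apply: (@continuous_comp _ _ _ (fun x => r ^+ 2 - (x + d) ^+ 2));
  last exact: sqrt_continuous.
apply: cvgB; first exact: cvg_cst.
apply: (@continuous_comp _ _ _ (fun x => x + d) (fun x => x ^+ 2));
  last exact: exprn_continuous.
by apply: cvgD; [exact: cvg_id|exact: cvg_cst].
Qed.

Lemma integral_half_chord d r : 0 <= d -> d <= r -> 0 < r ->
  (\int[lebesgue_measure]_(x in `[0%R, (r - d)%R])
    (Num.sqrt (r ^+ 2 - (x + d) ^+ 2))%:E =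
   ((r ^+ 2 * acos (d / r) - d * Num.sqrt (r ^+ 2 - d ^+ 2)) / 2)%:E)%E.
Proof.
move=> d0; rewrite le_eqVlt => /predU1P[<-|dr] r0.
  rewrite subrr set_itv1 integral_set1 divff ?gt_eqF// acos1 subrr sqrtr0.
  by rewrite !mulr0 subrr mul0r.
pose F x := ((x + d) * Num.sqrt (r ^+ 2 - (x + d) ^+ 2) -
  r ^+ 2 * acos ((x + d) / r)) / 2.
have cs := @continuous_half_chord d r.
have cF : {within `[0, r - d], continuous F}.
  have ca : {within `[0, r - d], continuous (fun x => acos ((x + d) / r))}.
    apply: (@within_continuous_comp R R R _ `[-1, 1]%classic
      (fun x : R => (x + d) / r) (@acos R)); last exact: within_continuous_acos.
      apply: continuous_subspaceT => x; apply: cvgMl; apply: cvgD;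
        [exact: cvg_id|exact: cvg_cst].
    move=> x; rewrite /= !in_itv/= => /andP[x0 xrd];
      rewrite ler_pdivlMr// ler_pdivrMr//; lra.
  move=> x; apply: cvgMl; apply: cvgB; last first.
    by apply: cvgMr; exact: ca.
  apply: cvgM; last by apply: (continuous_subspaceT cs).
  have : continuous (fun x => x + d) by move=> y; apply: cvgD;
    [exact: cvg_id|exact: cvg_cst].
  by move=> /continuous_subspaceT; exact.
have rd0 : 0 < r - d by lra.
have dF x : x \in `]0, r - d[ ->
  is_derive x 1 F (Num.sqrt (r ^+ 2 - (x + d) ^+ 2)).
  by rewrite in_itv/= => /andP[x0 xrd]; apply: is_derive_half_chord => //; lra.
rewrite (continuous_FTC2 (F := F))//.
- rewrite -EFinB /F; congr (_%:E).
  rewrite subrK divff ?gt_eqF// acos1 subrr sqrtr0 add0r; lra.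
- exact: continuous_subspaceT.
- have [_ Fl Fr] := (continuous_within_itvP F rd0).1 cF.
  split=> // x xI; exact: (@ex_derive _ _ _ _ _ _ _ (dF x xI)).
- by move=> x xI; rewrite derive1E; exact: (@derive_val _ _ _ _ _ _ _ (dF x xI)).
Qed.

(** The chord length is even in [x], which doubles the integral over the half-line, and it vanishes
    beyond [r - d]. *)
Lemma area_lens d r : 0 <= d -> d <= r -> 0 < r ->
  area (lens d r) = (2 * r ^+ 2 * acos (d / r) -
    2 * d * Num.sqrt (r ^+ 2 - d ^+ 2))%:E.
Proof.
move=> d0 dr r0.
transitivity (\int[lebesgue_measure]_x
  (2 * Num.sqrt (r ^+ 2 - (`|x| + d) ^+ 2))%:E)%E.
  by apply: eq_integral => x _; exact: lebesgue_measure_xsection_lens.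
rewrite ge0_symfun_integralT; last 3 first.
- by move=> x; rewrite mulr_ge0// sqrtr_ge0.
- move=> x; apply: cvgM; first exact: cvg_cst.
  exact: (continuous_comp (@norm_continuous _ _ x)
    (@continuous_half_chord d r _)).
- by move=> x /=; rewrite normrN.
transitivity (2 * (2 * \int[lebesgue_measure]_(x in `[0%R, (r - d)%R])
  (Num.sqrt (r ^+ 2 - (x + d) ^+ 2))%:E))%E; last first.
  by rewrite integral_half_chord// -!EFinM; congr (_%:E); field.
congr (2 * _)%E; rewrite -ge0_integralZl//; last first.
  apply: measurable_funTS; apply/measurable_EFinP.
  by apply: continuous_measurable_fun; exact: continuous_half_chord.
rewrite [LHS]integral_mkcond [RHS]integral_mkcond.
apply: eq_integral => x _.
rewrite !patchE; have [x0|x0] := leP 0 x; last first.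
  rewrite memNset/=; last by apply/negP; rewrite -ltNge.
  by rewrite memNset//= in_itv/= leNgt x0.
rewrite mem_set//; have [xr|xr] := leP x (r - d).
  by rewrite mem_set/= ?in_itv/= ?x0//= ger0_norm// EFinM.
rewrite memNset/=; last by rewrite in_itv/= x0 leNgt xr.
by rewrite ler0_sqrtr ?mulr0// ger0_norm//; nra.
Qed.

End lens.

(** * Level sets of [shat] *)

Section shat_geometry.
Context {R : realType}.
Implicit Types (x xs xd : R * R) (d r : R).

Lemma eucl_dist_ge0 x xs : 0 <= eucl_dist x xs.
Proof. exact: sqrtr_ge0. Qed.

Lemma eucl_distC x xs : eucl_dist x xs = eucl_dist xs x.
Proof. by congr Num.sqrt; ring. Qed.

Lemma eucl_dist_sqr x xs :
  eucl_dist x xs ^+ 2 = (x.1 - xs.1) ^+ 2 + (x.2 - xs.2) ^+ 2.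
Proof. by rewrite sqr_sqrtr// addr_ge0// sqr_ge0. Qed.

Lemma eucl_dist_le x xs r : 0 <= r ->
  (eucl_dist x xs <= r) = ((x.1 - xs.1) ^+ 2 + (x.2 - xs.2) ^+ 2 <= r ^+ 2).
Proof.
by move=> r0; rewrite -eucl_dist_sqr ler_pXn2r ?nnegrE ?eucl_dist_ge0.
Qed.

Lemma eucl_dist_le0 (x y : R * R) : eucl_dist x y <= 0 -> x = y.
Proof.
case: x y => [a b] [a' b']; rewrite eucl_dist_le// expr0n/= => le0.
have a2 := sqr_ge0 (a - a'); have b2 := sqr_ge0 (b - b').
have /eqP : (a - a') ^+ 2 = 0 by lra.
have /eqP : (b - b') ^+ 2 = 0 by lra.
by rewrite !sqrf_eq0 !subr_eq0 => /eqP -> /eqP ->.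
Qed.

Lemma shatC xs xd x : shat xs xd x = shat xd xs x.
Proof. by rewrite /shat maxC eucl_distC (eucl_distC xs). Qed.

Lemma measurable_eucl_dist xs : measurable_fun setT (eucl_dist xs).
Proof.
have ms : measurable_fun setT (@Num.sqrt R).
  by apply: continuous_measurable_fun; exact: sqrt_continuous.
have mq : measurable_fun setT
  (fun x : R * R => (xs.1 - x.1) ^+ 2 + (xs.2 - x.2) ^+ 2).
  by apply: measurable_funD; apply: measurable_funX; apply: measurable_funB.
exact: (measurableT_comp ms mq).
Qed.

Lemma measurable_shat xs xd : measurable_fun setT (shat xs xd).
Proof.
apply: measurable_maxr; first exact: measurable_eucl_dist.
by under eq_fun do rewrite eucl_distC; exact: measurable_eucl_dist.
Qed.

Lemma measurable_shat_le xs xd r : measurable [set x | shat xs xd x <= r].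
Proof.
rewrite -[X in measurable X]setTI; apply: measurable_fun_le => //.
exact: measurable_shat.
Qed.

(** Here [m] is the midpoint of the two terminals and [(c, s)] the unit vector along their axis. The
    translation by [m] is a product of two shears with constant functions. *)
Lemma area_shat_axis (m : R * R) (c s d r : R) :
  c ^+ 2 + s ^+ 2 = 1 -> c != -1 -> 0 <= d -> 0 <= r ->
  area [set x | shat (m.1 - d * c, m.2 - d * s) (m.1 + d * c, m.2 + d * s) x <=
    r] =
  area (lens d r).
Proof.
move=> cs1 c1 d0 r0.
have mL := measurable_lens d r.
have cs1' : c ^+ 2 + (- s) ^+ 2 = 1 by rewrite sqrrN.
rewrite -(area_rotation cs1' c1 mL).
set L1 := _ @^-1` lens d r.
have mL1 : measurable L1.
  rewrite -[L1]setTI; suff : measurable_fun [set: R * R]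
    (fun p => (c * p.1 - - s * p.2, - s * p.1 + c * p.2)) by exact.
  by apply/measurable_fun_pairP; split => /=;
    [apply: measurable_funB|apply: measurable_funD]; apply: measurable_funM.
have mcst k : measurable_fun setT (fun _ : R => k : R) by [].
rewrite -(area_shearl (mcst (- m.1)) mL1).
set L2 := _ @^-1` L1.
have mL2 : measurable L2.
  rewrite -[L2]setTI; exact: (measurable_shearl (mcst (- m.1))).
rewrite -(area_shearr (mcst (- m.2)) mL2).
congr (area _); apply/seteqP; split=> -[x y]; rewrite /L2 /L1 /lens /shat /=
  ge_max !eucl_dist_le//=; set u := c * _ - _; set v := _ * _ + _ * _.
(* In the coordinates [u] along the axis and [v] across it, the terminals are [(- d, 0)] and
   [(d, 0)]. The intermediate forms isolate [c ^+ 2 + s ^+ 2], to be replaced by 1. *)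
all: have E1 : (m.1 - d * c - x) ^+ 2 + (m.2 - d * s - y) ^+ 2 =
  (u + d) ^+ 2 + v ^+ 2.
1, 3: transitivity ((x - m.1) ^+ 2 + (y - m.2) ^+ 2 + 2 * d * u +
  d ^+ 2 * (c ^+ 2 + s ^+ 2));
  [rewrite /u; ring|].
1, 2: transitivity ((c ^+ 2 + s ^+ 2) * ((x - m.1) ^+ 2 + (y - m.2) ^+ 2) +
  2 * d * u + d ^+ 2);
  [rewrite cs1; ring|rewrite /u /v; ring].
all: have E2 : (x - (m.1 + d * c)) ^+ 2 + (y - (m.2 + d * s)) ^+ 2 =
  (u - d) ^+ 2 + v ^+ 2.
1, 3: transitivity ((x - m.1) ^+ 2 + (y - m.2) ^+ 2 - 2 * d * u +
  d ^+ 2 * (c ^+ 2 + s ^+ 2));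
  [rewrite /u; ring|].
1, 2: transitivity ((c ^+ 2 + s ^+ 2) * ((x - m.1) ^+ 2 + (y - m.2) ^+ 2) -
  2 * d * u + d ^+ 2);
  [rewrite cs1; ring|rewrite /u /v; ring].
all: rewrite {}E1 {}E2.
  by move=> /andP[? ?]; case: (ger0P u) => u0 //;
    rewrite (_ : - u + d = - (u - d)) ?sqrrN//; ring.
case: (ger0P u) => u0 H; apply/andP; split; nra.
Qed.

Lemma area_shat_le xs xd d r : 0 < d -> eucl_dist xs xd = 2 * d -> d <= r ->
  area [set x | shat xs xd x <= r] =
  (2 * r ^+ 2 * acos (d / r) - 2 * d * Num.sqrt (r ^+ 2 - d ^+ 2))%:E.
Proof.
move=> d0 dsd dr; rewrite -area_lens//; [|lra|lra].
have d20 : 2 * d != 0 by rewrite mulf_neq0// gt_eqF.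
(* The excluded rotation angle [pi] is avoided by exchanging [xs] and [xd]. *)
wlog c1 : xs xd dsd / (xd.1 - xs.1) / (2 * d) != -1.
  move=> H; have [c1|c1] := eqVneq ((xd.1 - xs.1) / (2 * d)) (-1); last exact: H.
  rewrite (_ : [set x | _] = [set x | shat xd xs x <= r]).
    by apply: H; rewrite 1?eucl_distC// -opprB mulNr c1; lra.
  by apply/seteqP; split=> x /=; rewrite shatC.
have cs1 : ((xd.1 - xs.1) / (2 * d)) ^+ 2 + ((xd.2 - xs.2) / (2 * d)) ^+ 2 = 1.
  rewrite !expr_div_n -mulrDl -eucl_dist_sqr eucl_distC dsd divff//.
  by rewrite expf_neq0.
pose m := ((xs.1 + xd.1) / 2, (xs.2 + xd.2) / 2).
have d0' : 0 <= d by lra.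
have r0 : 0 <= r by lra.
have exs : (m.1 - d * ((xd.1 - xs.1) / (2 * d)),
  m.2 - d * ((xd.2 - xs.2) / (2 * d))) = xs.
  by rewrite [RHS]surjective_pairing /m /=; congr pair; field; rewrite gt_eqF.
have exd : (m.1 + d * ((xd.1 - xs.1) / (2 * d)),
  m.2 + d * ((xd.2 - xs.2) / (2 * d))) = xd.
  by rewrite [RHS]surjective_pairing /m /=; congr pair; field; rewrite gt_eqF.
by have := area_shat_axis m cs1 c1 d0' r0; rewrite exs exd.
Qed.

End shat_geometry.

(** * The law of the optimal relay *)

Section opt_density.
Context {R : realType}.
Implicit Types (lambda d r : R).

(* [exp (- lambda * area)] for the lens of parameters [d] and [r]. *)
Definition void_prob lambda d r : R :=
  expR (- (lambda * (2 * r ^+ 2 * acos (d / r) -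
    2 * d * Num.sqrt (r ^+ 2 - d ^+ 2)))).

(** Multiplying out [d ^+ 2] turns the exponent into [lambda] times the area of the lens, so the
    exponential is the probability that the lens is empty. *)
Lemma f_Gamma_optE lambda d r : 0 < d -> d <= r ->
  f_Gamma_opt lambda d r = 4 * lambda * r * acos (d / r) * void_prob lambda d r.
Proof.
move=> d0 dr; have r0 : 0 < r by lra.
rewrite /f_Gamma_opt indicE mem_set/= ?in_itv/= ?dr// mulr1 /arcsec invf_div.
congr (_ * expR (- _)).
rewrite (_ : (r / d) ^+ 2 - 1 = (r ^+ 2 - d ^+ 2) / d ^+ 2); last by field;
  rewrite gt_eqF.
rewrite sqrtrM; last by nra.
rewrite sqrtrV ?sqr_ge0// sqrtr_sqr gtr0_norm//.
by field; rewrite gt_eqF.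
Qed.

Lemma f_Gamma_opt_lt lambda d r : r < d -> f_Gamma_opt lambda d r = 0.
Proof.
by move=> rd; rewrite /f_Gamma_opt indicE memNset ?mulr0//= in_itv/= andbT leNgt
  rd.
Qed.

Lemma f_Gamma_opt_le lambda d r : 0 < d -> r <= d -> f_Gamma_opt lambda d r = 0.
Proof.
move=> d0; rewrite le_eqVlt => /predU1P[->|]; last exact: f_Gamma_opt_lt.
by rewrite f_Gamma_optE// divff ?gt_eqF// acos1 mulr0 mul0r.
Qed.

Lemma f_Gamma_opt_ge0 lambda d r : 0 < lambda -> 0 < d ->
  0 <= f_Gamma_opt lambda d r.
Proof.
move=> l0 d0; have [rd|dr] := ltP r d; first by rewrite f_Gamma_opt_lt.
have r0 : 0 < r by lra.
rewrite f_Gamma_optE// mulr_ge0 ?expR_ge0// mulr_ge0//;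
  first by rewrite !mulr_ge0// ltW.
by apply: acos_ge0; rewrite ler_pdivlMr// ler_pdivrMr//; lra.
Qed.

Lemma within_continuous_acos_div d : 0 < d ->
  {within `[d, +oo[, continuous (fun r => acos (d / r))}.
Proof.
move=> d0.
apply: (@within_continuous_comp R R R _ `[-1, 1]%classic (fun r : R => d / r)
  (@acos R));
  last exact: within_continuous_acos.
  apply: continuous_in_subspaceT => x; rewrite inE/= in_itv/= andbT => dx.
  by apply: cvgMr; apply: cvgV; [rewrite gt_eqF//; lra|exact: cvg_id].
move=> x; rewrite /= !in_itv/= andbT => dx.
by rewrite ler_pdivlMr ?ler_pdivrMr; lra.
Qed.

Lemma within_continuous_void_prob lambda d : 0 < d ->
  {within `[d, +oo[, continuous (void_prob lambda d)}.
Proof.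
move=> d0.
apply: (@within_continuous_comp R R R _ setT _ (@expR R)) => //; last first.
  exact/continuous_subspaceT/continuous_expR.
have c1 : {within `[d, +oo[, continuous (fun r : R => 2 * r ^+ 2)}.
  apply: continuous_subspaceT => x; apply: cvgMr; exact: exprn_continuous.
have c2 : {within `[d, +oo[,
  continuous (fun r : R => Num.sqrt (r ^+ 2 - d ^+ 2))}.
  apply: continuous_subspaceT => x.
  apply: (@continuous_comp R R R (fun x => x ^+ 2 - d ^+ 2) (@Num.sqrt R));
    last exact: sqrt_continuous.
  by apply: cvgB; [exact: exprn_continuous|exact: cvg_cst].
have c3 := within_continuous_acos_div d0.
move=> x; apply: cvgN; apply: cvgMr; apply: cvgB; last by apply: cvgMr; exact: c2.
by apply: cvgM; [exact: c1|exact: c3].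
Qed.

Lemma within_continuous_density lambda d : 0 < d ->
  {within `[d, +oo[, continuous
    (fun r => 4 * lambda * r * acos (d / r) * void_prob lambda d r)}.
Proof.
move=> d0.
have c1 : {within `[d, +oo[, continuous (fun r : R => 4 * lambda * r)}.
  by apply: continuous_subspaceT => x; apply: cvgMr; exact: cvg_id.
have c2 := within_continuous_acos_div d0.
have c3 := @within_continuous_void_prob lambda d d0.
by move=> x; apply: cvgM; [apply: cvgM; [exact: c1|exact: c2]|exact: c3].
Qed.

(** The derivatives of the arccosine and of the square root cancel, which leaves [4 r acos (d / r)]
    for the derivative of the area: the perimeter of the lens, made of two arcs of radius [r] and
    half-angle [acos (d / r)]. *)
Lemma is_derive_void_prob lambda d r : 0 < d -> d < r ->
  is_derive r 1 (void_prob lambda d)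
    (- (4 * lambda * r * acos (d / r) * void_prob lambda d r)).
Proof.
move=> d0 dr; have r0 : 0 < r by lra.
have h1 : 0 < r ^+ 2 - d ^+ 2 by nra.
have h2 : -1 < d / r < 1 by rewrite ltr_pdivlMr// ltr_pdivrMr//; lra.
have ds := is_derive1_sqrt h1.
have da := is_derive1_acos h2.
have dq : is_derive r 1 (fun x => x ^+ 2 - d ^+ 2) (2 * r).
  by apply: is_derive_eq; rewrite /GRing.scale /=; ring.
have dhr : is_derive r 1 (fun x => d / x) (- d / r ^+ 2).
  have dV : is_derive r 1 (fun x : R => x^-1) (- r ^- 2 *: 1)
    by apply: is_deriveV; rewrite gt_eqF.
  by apply: is_derive_eq; rewrite /GRing.scale /=; field; rewrite gt_eqF.
have d1 := is_derive1_comp (f := Num.sqrt) (g := fun x => x ^+ 2 - d ^+ 2) ds dq.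
have d2 := is_derive1_comp (f := @acos R) (g := fun x => d / x) da dhr.
have comb (f1 f2 : R -> R) a b : is_derive r 1 f1 a -> is_derive r 1 f2 b ->
    is_derive r 1 (fun x => - (lambda * (2 * x ^+ 2 * f2 x - 2 * d * f1 x)))
      (- (lambda * (4 * r * f2 r + 2 * r ^+ 2 * b - 2 * d * a))).
  by move=> ? ?; apply: is_derive_eq; rewrite /GRing.scale /=; ring.
have d3 := comb _ _ _ _ d1 d2.
have d4 := is_derive1_comp (f := @expR R) (is_derive_expR _) d3.
apply: (is_derive_eq d4); rewrite /= /void_prob.
set s := Num.sqrt (r ^+ 2 - _).
have s0 : 0 < s by rewrite sqrtr_gt0.
have -> : Num.sqrt (1 - (d / r) ^+ 2) = s / r.
  rewrite (_ : 1 - _ = (r ^+ 2 - d ^+ 2) / r ^+ 2); last by field; rewrite gt_eqF.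
  by rewrite sqrtrM ?ltW// sqrtrV ?sqr_ge0// sqrtr_sqr gtr0_norm.
field.
by rewrite !gt_eqF.
Qed.

(** [- void_prob] is a primitive of the density; [r1 = d] is allowed because continuity is enough at
    the end points. *)
Lemma integral_f_Gamma_opt lambda d r1 r2 : 0 < d -> d <= r1 -> r1 < r2 ->
  (\int[lebesgue_measure]_(r in `[r1, r2]) (f_Gamma_opt lambda d r)%:E =
   (void_prob lambda d r1 - void_prob lambda d r2)%:E)%E.
Proof.
move=> d0 dr1 r12.
transitivity (\int[lebesgue_measure]_(r in `[r1, r2])
    (4 * lambda * r * acos (d / r) * void_prob lambda d r)%:E)%E.
  apply: eq_integral => x; rewrite inE/= in_itv/= => /andP[rx _].
  by rewrite f_Gamma_optE//; lra.
have sub : `[r1, r2] `<=` `[d, +oo[%classic.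
  by move=> x; rewrite /= !in_itv/= andbT => /andP[? _]; lra.
have cV := continuous_subspaceW sub (@within_continuous_void_prob lambda d d0).
have cNV : {within `[r1, r2], continuous (fun r => - void_prob lambda d r)}.
  by move=> x; apply: cvgN; exact: cV.
have dV r : r \in `]r1, r2[ -> is_derive r 1 (fun r => - void_prob lambda d r)
    (4 * lambda * r * acos (d / r) * void_prob lambda d r).
  rewrite in_itv/= => /andP[r1r _]; rewrite -[X in is_derive _ _ _ X]opprK.
  by apply: is_deriveN; apply: is_derive_void_prob => //; lra.
rewrite (continuous_FTC2 (F := fun r => - void_prob lambda d r))//.
- by rewrite -EFinB; congr (_%:E); ring.
- exact: continuous_subspaceW (@within_continuous_density lambda d d0).
- have [_ Fl Fr] := (continuous_within_itvP _ r12).1 cNV.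
  split; [|exact: Fl|exact: Fr].
  by move=> x xI; exact: (@ex_derive _ _ _ _ _ _ _ (dV x xI)).
- by move=> x xI; rewrite derive1E; exact: (@derive_val _ _ _ _ _ _ _ (dV x xI)).
Qed.

Lemma measurable_f_Gamma_opt lambda d : 0 < d ->
  measurable_fun setT (f_Gamma_opt lambda d).
Proof.
move=> d0.
have -> : f_Gamma_opt lambda d =
    (fun r => 4 * lambda * r * acos (d / r) * void_prob lambda d r) \_ `[d, +oo[.
  apply/funext => r; rewrite patchE; case: ifPn;
    rewrite ?inE ?notin_setE/= in_itv/= andbT => dr.
    exact: f_Gamma_optE.
  by apply: f_Gamma_opt_lt; rewrite ltNge; exact/negP.
apply/(measurable_restrictT _ _).1 => //.
apply: subspace_continuous_measurable_fun => //.
exact: within_continuous_density.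
Qed.

End opt_density.

(** * Relays, feedback events and their measurability *)

Section relays.
Context {dsp : measure_display} {Omega : measurableType dsp} {R : realType}.
Implicit Types (Phi : Omega -> set (R * R)) (xs xd : R * R) (r : R) (w : Omega).

Lemma finite_set_argmin (T : eqType) (A : set T) (f : T -> R) :
  finite_set A -> A !=set0 -> exists2 x, A x & forall y, A y -> f x <= f y.
Proof.
move=> /finite_seqP[s ->]; elim: s => [[x]//|a [|b s] IH _].
  by exists a => [|y]; rewrite /= inE// => /eqP ->.
have [|x xs xmin] := IH; first by exists b; rewrite /= mem_head.
have [fax|fxa] := leP (f a) (f x).
  exists a => [|y]; rewrite /= inE ?eqxx// => /predU1P[->//|/xmin];
    exact: le_trans.
exists x => [|y]; rewrite /= inE; first by rewrite [X in _ || X]xs orbT.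
by move=> /predU1P[->|/xmin//]; exact: ltW.
Qed.

Lemma pp_count0 Phi A w : (pp_count Phi A w = 0%:E :> \bar R) <-> Phi w `&` A =
  set0.
Proof.
rewrite /pp_count /counting; split => [|->].
  case: ifPn => // /asboolP fs [] /eqP.
  by rewrite pnatr_eq0 finmap.cardfs_eq0 => /eqP /(fset_set_set0 fs).
by rewrite asboolT ?fset_set0 ?finmap.cardfs0//; exact: finite_set0.
Qed.

Lemma bounded_shat_le xs xd r : bounded_set [set x | shat xs xd x <= r].
Proof.
exists (`|xs.1| + `|xs.2| + `|r|); split; first exact: num_real.
move=> y ry x /=; rewrite /shat ge_max => /andP[xr _].
have r0 : 0 <= r by exact: le_trans (eucl_dist_ge0 _ _) xr.
move: xr; rewrite eucl_dist_le// => xr.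
have n1 : `|xs.1 - x.1| <= r.
  rewrite -(ler_pXn2r (n := 2)) ?nnegrE// real_normK ?num_real//.
  by have := sqr_ge0 (xs.2 - x.2); lra.
have n2 : `|xs.2 - x.2| <= r.
  rewrite -(ler_pXn2r (n := 2)) ?nnegrE// real_normK ?num_real//.
  by have := sqr_ge0 (xs.1 - x.1); lra.
have t1 : `|x.1| <= `|xs.1| + `|xs.1 - x.1|.
  by rewrite -{1}(subKr xs.1 x.1) ler_normB.
have t2 : `|x.2| <= `|xs.2| + `|xs.2 - x.2|.
  by rewrite -{1}(subKr xs.2 x.2) ler_normB.
rewrite (ger0_norm r0) in ry.
have := normr_ge0 xs.1; have := normr_ge0 xs.2 => ? ?.
by rewrite /Num.norm/= ge_max; apply/andP; split; lra.
Qed.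

(** The triangle inequality in squared form: [|a + b|^2 <= 2 |a|^2 + 2 |b|^2] with [a = xs - x] and
    [b = x - xd], the gap being [|a - b|^2]. *)
Lemma shat_ge xs xd (d : R) x : eucl_dist xs xd = 2 * d -> d <= shat xs xd x.
Proof.
move=> dsd; rewrite leNgt; apply/negP; rewrite gt_max => /andP[sx xd_].
have d0 : 0 < d by exact: le_lt_trans (eucl_dist_ge0 _ _) sx.
have s2 : eucl_dist xs x ^+ 2 < d ^+ 2 by rewrite ltr_pXn2r ?nnegrE
  ?eucl_dist_ge0 ?ltW.
have d2 : eucl_dist x xd ^+ 2 < d ^+ 2 by rewrite ltr_pXn2r ?nnegrE
  ?eucl_dist_ge0 ?ltW.
have := eucl_dist_sqr xs xd; rewrite dsd.
move: s2 d2; rewrite !eucl_dist_sqr.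
have := sqr_ge0 ((xs.1 - x.1) - (x.1 - xd.1)); have :=
  sqr_ge0 ((xs.2 - x.2) - (x.2 - xd.2)).
by nra.
Qed.

(** There may be infinitely many relays, but those at least as good as a given [X0] lie in a bounded
    set and are finitely many; a minimizer among them is a global one. *)
Lemma Gamma_opt_attained Phi xs xd w : point_process Phi -> Phi w !=set0 ->
  exists2 X, Phi w X & Gamma_opt Phi xs xd w = shat xs xd X /\
    forall Y, Phi w Y -> shat xs xd X <= shat xs xd Y.
Proof.
move=> [fin _] [X0 PX0].
have [||X [PX XX0] Xmin] :=
  @finite_set_argmin _ (Phi w `&` [set x | shat xs xd x <= shat xs xd X0])
    (shat xs xd).
- exact/fin/bounded_shat_le.
- by exists X0; split => /=.
have XY Y : Phi w Y -> shat xs xd X <= shat xs xd Y.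
  move=> PY; have [YX0|X0Y] := leP (shat xs xd Y) (shat xs xd X0);
    first exact: Xmin.
  by apply: le_trans XX0 (ltW _).
exists X => //; split=> //; apply/eqP; rewrite eq_le; apply/andP; split.
  apply: ge_inf; last by exists X.
  by exists (shat xs xd X) => _ [Y PY <-]; exact: XY.
apply: lb_le_inf; first by exists (shat xs xd X), X.
by move=> _ [Y PY <-]; exact: XY.
Qed.

Lemma Gamma_opt_set0 Phi xs xd w : Phi w = set0 -> Gamma_opt Phi xs xd w = 0.
Proof. by move=> P0; rewrite /Gamma_opt P0 image_set0 inf0. Qed.

Lemma feedback_eventE Phi xs xd r w : point_process Phi ->
  feedback_event Phi xs xd r w <-> Phi w !=set0 /\ Gamma_opt Phi xs xd w <= r.
Proof.
move=> pp; split.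
  move=> [X [PX Xr]]; have P0 : Phi w !=set0 by exists X.
  split=> //; have [Y PY [-> YX]] := Gamma_opt_attained xs xd pp P0.
  by apply: le_trans (YX _ PX) _.
move=> [P0]; have [Y PY [-> _]] := Gamma_opt_attained xs xd pp P0.
by move=> Yr; exists Y.
Qed.

(** Expressing feedback through a count gives both its membership in [pp_sigma Phi] and, by the
    Poisson law, its probability. *)
Lemma feedback_eventC Phi xs xd r :
  ~` feedback_event Phi xs xd r =
    pp_count Phi [set x | shat xs xd x <= r] @^-1` [set 0%:E].
Proof.
apply/seteqP; split => w /=.
  move=> nfb; apply/pp_count0; apply/seteqP; split=> // X [PX Xr].
  by apply: nfb; exists X.
by move=> /pp_count0 P0 [X [PX Xr]]; have : set0 X by rewrite -P0.
Qed.

Lemma pp_sigma_measurable Phi : point_process Phi -> pp_sigma Phi `<=` measurable.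
Proof.
move=> [_ mP]; apply: smallest_sub; first exact: sigma_algebra_measurable.
by move=> _ [A mA [B mB <-]]; apply: mP.
Qed.

Lemma pp_sigma_count Phi A B : measurable A -> measurable B ->
  pp_sigma Phi (pp_count Phi A @^-1` B).
Proof.
move=> mA mB; apply: sub_sigma_algebra; exists A => //; exists B => //.
by rewrite setTI.
Qed.

Lemma pp_sigmaC Phi A : pp_sigma Phi A -> pp_sigma Phi (~` A).
Proof.
move=> FA; rewrite -setTD.
by have [_ + _] : sigma_algebra setT (pp_sigma Phi) :=
  smallest_sigma_algebra _ _; apply.
Qed.

Lemma pp_sigma_feedback Phi xs xd r : pp_sigma Phi (feedback_event Phi xs xd r).
Proof.
rewrite -[feedback_event _ _ _ _]setCK feedback_eventC; apply: pp_sigmaC.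
apply: pp_sigma_count; first exact: measurable_shat_le.
exact: emeasurable_set1.
Qed.

Lemma measurable_Gamma_opt Phi xs xd : point_process Phi ->
  measurable_fun setT (Gamma_opt Phi xs xd).
Proof.
move=> pp mT.
have mfb r : measurable (feedback_event Phi xs xd r).
  by apply: (pp_sigma_measurable pp); exact: pp_sigma_feedback.
have m0 : measurable [set w | Phi w = set0].
  rewrite (_ : [set w | _] = setT `&` pp_count Phi setT @^-1` [set 0%:E]).
    by case: pp => _ mP; apply: mP => //; exact: emeasurable_set1.
  by rewrite setTI; apply/seteqP; split=> w /=; rewrite pp_count0 setIT.
apply: (measurability _ (RGenOInfty.measurableE R)) => //.
move=> _ [_ [r ->] <-]; rewrite setTI.
(* Where relays exist, [Gamma_opt > r] means that none feeds back at threshold [r]; where there is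
   none, [Gamma_opt] is 0 and the condition is [r < 0]. *)
have -> : Gamma_opt Phi xs xd @^-1` `]r, +oo[%classic =
    (~` feedback_event Phi xs xd r `\` [set w | Phi w = set0]) `|`
    ([set w | Phi w = set0] `&` [set w | r < 0]).
  apply/seteqP; split=> w /=; rewrite in_itv/= andbT.
    have [P0|/eqP/set0P P0] := pselect (Phi w = set0).
      by rewrite Gamma_opt_set0//; right.
    move=> rG; left; split; last by move=> P0'; rewrite P0' in P0; case: P0.
    by rewrite feedback_eventE// => -[_]; rewrite leNgt rG.
  move=> [[nfb /eqP/set0P P0]|[P0 r0]]; last by rewrite Gamma_opt_set0.
  by rewrite ltNge; apply/negP => Gr; apply: nfb; apply/feedback_eventE.
apply: measurableU; first by apply: measurableD => //; exact: measurableC.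
apply: measurableI => //.
by case: (boolP (r < 0)) => _; rewrite ?set_true ?set_false.
Qed.

End relays.

Section opt_law.
Context {dsp : measure_display} {Omega : measurableType dsp} {R : realType}.
Variables (P : probability Omega R) (lambda : R) (Phi : Omega -> set (R * R)).
Hypotheses (lambda_gt0 : 0 < lambda) (PhiPPP : homogeneous_PPP P lambda Phi).
Variables (xs xd : R * R) (d : R).
Hypotheses (d_gt0 : 0 < d) (dist_sd : eucl_dist xs xd = 2 * d).

Let pp : point_process Phi. Proof. by case: PhiPPP. Qed.

Lemma void_probability (A : set (R * R)) : measurable A -> bounded_set A ->
  P (pp_count Phi A @^-1` [set 0%:E]) = (expR (- (lambda * fine (area A))))%:E.
Proof.
move=> mA bA; have [_ /(_ A mA bA 0%N) -> _] := PhiPPP.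
rewrite /poisson_prob; case: ifPn => [l0|].
  rewrite esum_set1 ?lee_fin ?poisson_pmf_ge0//.
  by rewrite /poisson_pmf l0 expr0 fact0 invr1 !mul1r.
(* A region of zero area: [poisson_prob] is then the Dirac mass at 0, in agreement with
   [expR 0 = 1]. *)
have /fine_ge0 a0 : (0 <= area A)%E by exact: measure_ge0.
rewrite -leNgt => l0; have -> : lambda * fine (area A) = 0.
  by apply/eqP; rewrite eq_le l0 mulr_ge0// ltW.
by rewrite oppr0 expR0 diracE mem_set.
Qed.

Let mfb r : measurable (feedback_event Phi xs xd r).
Proof. by apply: (pp_sigma_measurable pp); exact: pp_sigma_feedback. Qed.

Lemma probability_feedback r : d <= r ->
  P (feedback_event Phi xs xd r) = (1 - void_prob lambda d r)%:E.
Proof.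
move=> dr; rewrite -[feedback_event _ _ _ _]setCK probability_setC;
  last exact: measurableC.
rewrite feedback_eventC void_probability; last 2 first.
- exact: measurable_shat_le.
- exact: bounded_shat_le.
by rewrite (area_shat_le d_gt0 dist_sd dr).
Qed.

Lemma void_prob_d : void_prob lambda d d = 1.
Proof.
by rewrite /void_prob divff ?gt_eqF// acos1 subrr sqrtr0 !mulr0 subrr mulr0 oppr0
  expR0.
Qed.

Let measurable_Phi0 : measurable [set w | Phi w = set0].
Proof.
rewrite (_ : [set w | _] = setT `&` pp_count Phi setT @^-1` [set 0%:E]).
  by case: pp => _ mP; apply: mP => //; exact: emeasurable_set1.
by rewrite setTI; apply/seteqP; split=> w /=; rewrite pp_count0 setIT.
Qed.

Lemma probability_Phi0 : P [set w | Phi w = set0] = 0%E.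
Proof.
(* The rectangle [0, a] x [0, 1] has area [a] and meets no relay. *)
have Pn (a : R) : 0 < a ->
  (P [set w | Phi w = set0] <= (expR (- (lambda * a)))%:E)%E.
  move=> a0; pose A : set (R * R) := `[0, a]%classic `*` `[0, 1]%classic.
  have mA : measurable A by apply: measurableX; exact: measurable_itv.
  have bA : bounded_set A.
    exists (a + 1); split; first exact: num_real.
    move=> y ay x /= []; rewrite /= !in_itv/= => /andP[x0 xa] /andP[x1 x2].
    by rewrite /Num.norm/= ge_max !ger0_norm//; apply/andP; split; lra.
  have := void_probability mA bA.
  rewrite /A /area product_measure1E//= !lebesgue_measure_itv/= !lte_fin a0 ltr01.
  rewrite -!EFinD -EFinM/= !subr0 mulr1 => <-.
  apply: le_measure; rewrite ?inE//.
    rewrite -[X in measurable X]setTI.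
    by case: pp => _ mP; apply: mP => //; exact: emeasurable_set1.
  by move=> w /= P0; apply/pp_count0; rewrite P0 set0I.
apply/eqP; rewrite eq_le measure_ge0 andbT leNgt; apply/negP => P0.
have fP : P [set w | Phi w = set0] \is a fin_num by exact: fin_num_measure.
move: P0 Pn; rewrite -(fineK fP) lte_fin => p0 Pn.
set p := fine _ in p0 Pn.
have p1 : p <= 1 by rewrite -lee_fin /p fineK// probability_le1.
(* This length of rectangle makes the bound equal to [p / 2], which contradicts [0 < p]. *)
have a0 : 0 < - ln (p / 2) / lambda.
  by rewrite divr_gt0// oppr_gt0 ln_lt0//; lra.
have := Pn _ a0; rewrite lee_fin mulrC divfK ?gt_eqF// opprK lnK ?posrE; lra.
Qed.

Lemma probability_Gamma_opt_itv (r1 r2 : R) : d <= r1 -> r1 < r2 ->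
  P (Gamma_opt Phi xs xd @^-1` `]r1, r2]) =
    (void_prob lambda d r1 - void_prob lambda d r2)%:E.
Proof.
move=> dr1 r12.
have -> : Gamma_opt Phi xs xd @^-1` `]r1, r2] =
    feedback_event Phi xs xd r2 `\` feedback_event Phi xs xd r1.
  apply/seteqP; split => w /=; rewrite in_itv/=; last first.
    rewrite !feedback_eventE// => -[[P0 ->]] n; rewrite andbT ltNge.
    by apply/negP => Gr1; apply: n.
  move=> /andP[rG Gr]; rewrite !feedback_eventE//; split;
    last by rewrite leNgt rG => -[].
  split=> //; apply/set0P/eqP => /(Gamma_opt_set0 xs xd) G0.
  by move: rG; rewrite G0 ltNge (le_trans _ dr1)// ltW.
rewrite measureD//=; last by rewrite (le_lt_trans (probability_le1 _ _))// ltry.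
rewrite setIidr; last first.
  by move=> w; rewrite !feedback_eventE// => -[? ?]; split => //; lra.
rewrite [X in (X - _)%E]probability_feedback; last by lra.
by rewrite [X in (_ - X)%E]probability_feedback// -EFinB; congr (_%:E); ring.
Qed.

(** Either there is no relay, or one feeds back at threshold [d]; the latter is null because the
    lens with [r = d] has zero area. *)
Lemma probability_Gamma_opt_le : P (Gamma_opt Phi xs xd @^-1` `]-oo, d]) = 0%E.
Proof.
apply/eqP; rewrite eq_le measure_ge0 andbT.
apply: (@le_trans _ _ (P ([set w | Phi w = set0] `|` feedback_event Phi xs xd
  d))).
  apply: le_measure; rewrite ?inE//.
  - rewrite -[X in measurable X]setTI; exact: measurable_Gamma_opt.
  - exact: measurableU.
  - move=> w /=; rewrite in_itv/= => Gd; have [P0|P0] := pselect (Phi w = set0);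
      first by left.
    by right; rewrite feedback_eventE//; split => //; exact/set0P/eqP.
have := measureU2 P measurable_Phi0 (mfb d).
rewrite [X in (_ <= X + _)%E]probability_Phi0 add0e => /le_trans; apply.
by rewrite [leLHS](probability_feedback (lexx d)) void_prob_d subrr.
Qed.

Lemma law_Gamma_opt (B : set R) : measurable B ->
  P (Gamma_opt Phi xs xd @^-1` B) =
  (\int[lebesgue_measure]_(gamma in B) (f_Gamma_opt lambda d gamma)%:E)%E.
Proof.
have mG := measurable_Gamma_opt xs xd pp.
have mGV (A : set R) : measurable A -> measurable (Gamma_opt Phi xs xd @^-1` A).
  by move=> mA; rewrite -[X in measurable X]setTI; exact: mG.
have mG' : measurable_fun setT (Gamma_opt Phi xs xd : Omega -> measurableTypeR R)
  by exact: mG.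
pose G : {mfun Omega >-> measurableTypeR R} :=
  HB.pack (Gamma_opt Phi xs xd : Omega -> measurableTypeR R)
    (isMeasurableFun.Build _ _ _ _ _ mG').
move: B; apply: (@measure_density_ocitv R (pushforward P G)) => [||r1 r2 _|r1 r2].
- exact: measurable_f_Gamma_opt.
- by move=> x; exact: f_Gamma_opt_ge0.
- transitivity (P (Gamma_opt Phi xs xd @^-1` `]r1, r2])) => //.
  (* Both sides may be cut at [d]: the law has no mass on []-oo, d]] and the density vanishes
     there. *)
  pose r := Num.max r1 d.
  transitivity (P (Gamma_opt Phi xs xd @^-1` `]r, r2])).
    apply/eqP; rewrite eq_le; apply/andP; split; last first.
      apply: le_measure; rewrite ?inE; [exact: mGV|exact: mGV|].
      by move=> w /=; rewrite !in_itv/= gt_max => /andP[/andP[-> _] ->].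
    rewrite -[leRHS]add0e -probability_Gamma_opt_le.
    apply: le_trans (measureU2 _ _ _); [|exact: mGV|exact: mGV].
    apply: le_measure; rewrite ?inE; [exact: mGV|apply: measurableU; exact: mGV|].
    move=> w /=; rewrite !in_itv/= => /andP[r1G Gr2].
    by have [Gd|dG] := leP (Gamma_opt Phi xs xd w) d;
      [left|right; rewrite gt_max r1G dG].
  transitivity (\int[lebesgue_measure]_(x in `]r, r2])
    (f_Gamma_opt lambda d x)%:E)%E; last first.
    rewrite [LHS]integral_mkcond [RHS]integral_mkcond; apply: eq_integral => x _.
    rewrite !patchE; have [dx|xd0] := ltP d x.
      congr (if _ then _ else _); apply/idP/idP;
        rewrite !inE/= !in_itv/= gt_max dx andbT//.
    by rewrite f_Gamma_opt_le//; case: ifP; case: ifP.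
  have [rr2|r2r] := ltP r r2; last first.
    by rewrite set_itv_ge ?preimage_set0 ?measure0 ?integral_set0// bnd_simp
      -leNgt.
  have dr : d <= r by rewrite le_max lexx orbT.
  rewrite integral_itv_obnd_cbnd; last first.
    by apply: measurable_funTS; apply/measurable_EFinP;
      exact: measurable_f_Gamma_opt.
  by rewrite integral_f_Gamma_opt//; exact: probability_Gamma_opt_itv.
- apply: le_lt_trans (ltry 1); exact/probability_le1/mGV.
Qed.

End opt_law.

(** * Rayleigh fading *)

Section exponential_integral.
Context {R : realType}.
Implicit Types a u : R.
Local Notation mu := (@lebesgue_measure R).

Lemma continuous_expRN : continuous (fun u => expR (- u)).
Proof. by move=> u; apply: continuous_comp;
  [exact: oppr_continuous|exact: continuous_expR]. Qed.

(** The bound [2 a e^(-u/2)] comes from [ln (1 + a u) <= a u] and [u / 2 <= e^(u/2)], one half of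
    the decay being spent on the growth of the logarithm. *)
Lemma cvg_ln1DM_expRN a : 0 <= a ->
  ln (1 + a * u) * expR (- u) @[u --> +oo] --> (0 : R).
Proof.
move=> a0; apply: (@squeeze_cvgr _ _ _ _ (fun=> 0)
  (fun u => 2 * a * expR (- (2^-1 * u)))).
- near=> u; have u0 : 0 <= u by near: u; exact: nbhs_pinfty_ge.
  have au0 : 0 <= a * u by rewrite mulr_ge0.
  rewrite mulr_ge0 ?expR_ge0 ?ln_ge0 ?lerDl//=.
  have -> : expR (- u) = expR (- (2^-1 * u)) * expR (- (2^-1 * u)).
    by rewrite -expRD; congr expR; field.
  rewrite mulrA ler_wpM2r ?expR_ge0// expRN ler_pdivrMr ?expR_gt0//.
  apply: (le_trans (le_ln1Dx _)); first by lra.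
  have h := expR_ge1Dx (2^-1 * u).
  by have := ler_wpM2l a0 h; lra.
- exact: cvg_cst.
- rewrite -[X in _ --> X](mulr0 (2 * a)); apply: cvgMr.
  apply: (@cvg_comp _ _ _ (fun u : R => 2^-1 * u) (fun z => expR (- z)) _
    (pinfty_nbhs R)); last exact: cvgr_expR.
  by apply: gt0_cvgMry => //; rewrite invr_gt0.
Unshelve. all: by end_near. Qed.

Lemma within_continuous_ln1DM a : 0 <= a ->
  {within `[0, +oo[, continuous (fun u => ln (1 + a * u))}.
Proof.
move=> a0; apply: continuous_in_subspaceT => u; rewrite inE/= in_itv/= andbT =>
  u0.
have h : 0 < 1 + a * u by have := mulr_ge0 a0 u0; lra.
apply: (@continuous_comp R R R (fun u => 1 + a * u) (@ln R));
  last exact: continuous_ln.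
by apply: cvgD; [exact: cvg_cst|apply: cvgMr; exact: cvg_id].
Qed.

Lemma within_continuous_inv1DM a : 0 <= a ->
  {within `[0, +oo[, continuous (fun u => a / (1 + a * u))}.
Proof.
move=> a0; apply: continuous_in_subspaceT => u; rewrite inE/= in_itv/= andbT =>
  u0.
have h : 0 < 1 + a * u by have := mulr_ge0 a0 u0; lra.
apply: cvgMr; apply: cvgV; first by rewrite gt_eqF.
by apply: cvgD; [exact: cvg_cst|apply: cvgMr; exact: cvg_id].
Qed.

Lemma integral_cst_expRN a : 0 <= a ->
  (\int[mu]_(u in `[0%R, +oo[) (a * expR (- u))%:E = a%:E)%E.
Proof.
move=> a0; rewrite (@ge0_continuous_FTC2y _ _ (fun u => - (a * expR (- u))) 0 0).
- by rewrite oppr0 expR0 mulr1 EFinN oppeK add0e.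
- by move=> u _; rewrite mulr_ge0 ?expR_ge0.
- by apply: continuous_subspaceT => u; apply: cvgMr; exact: continuous_expRN.
- rewrite -oppr0 -(mulr0 a); apply: cvgN; apply: cvgMr; exact: cvgr_expR.
- by move=> u _; exact: ex_derive.
- by apply: cvg_at_right_filter; apply: cvgN; apply: cvgMr;
    exact: continuous_expRN.
- move=> u _; rewrite derive1E; apply: derive_val.
  by apply: is_derive_eq; rewrite /GRing.scale/=; ring.
Qed.

(* The two sides differ by the integral of the derivative of
   [- ln (1 + a u) e^-u]; adding [a e^-u] makes all integrands nonnegative. *)
Lemma integral_ln1DM_expRN a : 0 <= a ->
  (\int[mu]_(u in `[0%R, +oo[) (ln (1 + a * u) * expR (- u))%:E =
   \int[mu]_(u in `[0%R, +oo[) (a / (1 + a * u) * expR (- u))%:E)%E.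
Proof.
move=> a0.
pose g u := ln (1 + a * u) * expR (- u) +
  (a * expR (- u) - a / (1 + a * u) * expR (- u)).
have au u : 0 <= u -> 0 < 1 + a * u by move=> u0; have := mulr_ge0 a0 u0; lra.
have h1_ge0 u : 0 <= u -> 0 <= ln (1 + a * u) * expR (- u).
  by move=> u0; rewrite mulr_ge0 ?expR_ge0 ?ln_ge0//; have := mulr_ge0 a0 u0; lra.
have h2_ge0 u : 0 <= u -> 0 <= a / (1 + a * u) * expR (- u).
  by move=> u0; rewrite mulr_ge0 ?expR_ge0// divr_ge0// ltW// au.
have g_ge0 u : 0 <= u -> 0 <= g u.
  move=> u0; rewrite addr_ge0 ?h1_ge0// -mulrBl mulr_ge0 ?expR_ge0// subr_ge0.
  rewrite ler_pdivrMr ?au//; have := mulr_ge0 a0 u0; nra.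
have ce : {within `[0, +oo[, continuous (fun u => expR (- u))}.
  exact/continuous_subspaceT/continuous_expRN.
have c1 : {within `[0, +oo[, continuous (fun u => ln (1 + a * u) * expR (- u))}.
  by move=> u; apply: cvgM; [exact: within_continuous_ln1DM|exact: ce].
have c2 : {within `[0, +oo[, continuous (fun u => a / (1 + a * u) * expR (- u))}.
  by move=> u; apply: cvgM; [exact: within_continuous_inv1DM|exact: ce].
have c3 : {within `[0, +oo[, continuous (fun u => a * expR (- u))}.
  by move=> u; apply: cvgMr; exact: ce.
have cg : {within `[0, +oo[, continuous g}.
  by move=> u; apply: cvgD; [exact: c1|apply: cvgB; [exact: c3|exact: c2]].
have mE (f : R -> R) : {within `[0, +oo[, continuous f} ->
  measurable_fun `[(0:R), +oo[ (EFin \o f).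
  by move=> cf; apply/measurable_EFinP; exact: subspace_continuous_measurable_fun.
pose F u := - (ln (1 + a * u) * expR (- u)) - a * expR (- u).
have dF u : 0 < u -> is_derive u 1 F (g u).
  move=> u0; have dl := is_derive1_ln (au _ (ltW u0)).
  have dlin : is_derive u 1 (fun u => 1 + a * u) a.
    by apply: is_derive_eq; rewrite /GRing.scale/=; ring.
  have dln := is_derive1_comp (f := @ln R) (g := fun u => 1 + a * u) dl dlin.
  have comb (f1 : R -> R) b : is_derive u 1 f1 b ->
      is_derive u 1 (fun u => - (f1 u * expR (- u)) - a * expR (- u))
        (f1 u * expR (- u) + (a * expR (- u) - b * expR (- u))).
    by move=> ?; apply: is_derive_eq; rewrite /GRing.scale/=; ring.
  by apply: (is_derive_eq (comb _ _ dln)); rewrite /g /=;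
    congr (_ + (_ - _ * _)); rewrite mulrC.
have ig : (\int[mu]_(u in `[0%R, +oo[) (g u)%:E = a%:E)%E.
  rewrite (@ge0_continuous_FTC2y _ _ F 0 0)//.
  - by rewrite -EFinB; congr (_%:E); rewrite /F !mulr0 addr0 ln1 oppr0 expR0;
      ring.
  - suff : F u @[u --> +oo] --> - (0 : R) - a * 0 by rewrite oppr0 mulr0 subr0.
    apply: cvgB; first by apply: cvgN; exact: cvg_ln1DM_expRN.
    by apply: cvgMr; exact: cvgr_expR.
  - by move=> u u0; have [] := dF _ u0.
  - have cF : {within `[0, +oo[, continuous F}.
      by move=> u; apply: cvgB; [apply: cvgN; exact: c1|exact: c3].
    by have [] := (continuous_within_itvcyP 0 F).1 cF.
  - by move=> u; rewrite in_itv/= andbT => u0; rewrite derive1E;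
      apply: derive_val; exact: dF.
have : (\int[mu]_(u in `[0%R, +oo[) (g u)%:E +
    \int[mu]_(u in `[0%R, +oo[) (a / (1 + a * u) * expR (- u))%:E =
  \int[mu]_(u in `[0%R, +oo[) (ln (1 + a * u) * expR (- u))%:E +
    \int[mu]_(u in `[0%R, +oo[) (a * expR (- u))%:E)%E.
  rewrite -!ge0_integralD//; try exact: mE.
  - by apply: eq_integral => u _; rewrite -!EFinD /g; congr (_%:E); ring.
  - by move=> u /=; rewrite in_itv/= andbT lee_fin; exact: h1_ge0.
  - by move=> u _; rewrite lee_fin mulr_ge0 ?expR_ge0.
  - by move=> u /=; rewrite in_itv/= andbT lee_fin; exact: g_ge0.
  - by move=> u /=; rewrite in_itv/= andbT lee_fin; exact: h2_ge0.
(* The two auxiliary integrals both equal the finite number [a], so they cancel although the other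
   two are not yet known to be finite. *)
by rewrite ig integral_cst_expRN// addeC => /(congr1 (fun x => x - a%:E)%E);
  rewrite !addeK.
Qed.

Lemma integral_ln1DM_E1 a : 0 < a ->
  (\int[mu]_(u in `[0%R, +oo[) (ln (1 + a * u) * expR (- u))%:E =
   (expR a^-1 * E1 a^-1)%:E)%E.
Proof.
move=> a0; rewrite integral_ln1DM_expRN ?ltW//.
(* Substitution [t = 1 + a u]: then [e^-u = e^(1/a) e^(-t/a)], which yields the factor in front of
   [E1]. *)
pose G t := expR (- (t - 1) / a) / t.
pose F u := 1 + a * u.
have F' : F^`()%classic = cst a.
  apply/funext => u; rewrite derive1E; apply: derive_val.
  by apply: is_derive_eq; rewrite /GRing.scale/=; ring.
have F0 : F 0 = 1 by rewrite /F mulr0 addr0.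
have cF : continuous F.
  by move=> u; apply: cvgD; [exact: cvg_cst|apply: cvgMr; exact: cvg_id].
have subst_G : (\int[mu]_(u in `[0%R, +oo[) (a / (1 + a * u) * expR (- u))%:E =
    \int[mu]_(t in `[1%R, +oo[) (G t)%:E)%E.
  transitivity (\int[mu]_(u in `[0%R, +oo[) (((G \o F) * F^`()%classic) u)%:E)%E.
    apply: eq_integral => u _; rewrite F' /G /F /=; congr (_%:E).
    rewrite [RHS]/GRing.mul/= (_ : - (1 + a * u - 1) / a = - u); first by ring.
    by field; rewrite gt_eqF.
  rewrite -increasing_ge0_integration_by_substitutiony ?F0//.
  - by move=> u v _ _ uv; rewrite /F ltrD2l ltr_pM2l.
  - by rewrite F' => u _; exact: cvg_cst.
  - by rewrite F'; exact: is_cvg_cst.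
  - by rewrite F'; exact: is_cvg_cst.
  - split; last by apply: cvg_at_right_filter; exact: cF.
    by move=> u _; rewrite /F; exact: ex_derive.
  - apply: (@cvg_comp _ _ _ (fun u : R => a * u) (fun v => 1 + v) _
      (pinfty_nbhs R)); last exact: cvg_addrl.
    exact: gt0_cvgMry.
  - apply: continuous_in_subspaceT => t; rewrite inE/= in_itv/= andbT => t1.
    apply: cvgM; last by apply: cvgV; [rewrite gt_eqF//; lra|exact: cvg_id].
    apply: (@continuous_comp R R R (fun t => - (t - 1) / a) (@expR R));
      last exact: continuous_expR.
    by apply: cvgMl; apply: cvgN; apply: cvgB; [exact: cvg_id|exact: cvg_cst].
  - move=> t; rewrite in_itv/= andbT => t1.
    by rewrite /G divr_ge0 ?expR_ge0//; lra.
pose K := (\int[mu]_(t in `[1%R, +oo[) (expR (- (t * a^-1)) / t)%:E)%E.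
have k_ge0 t : `[1, +oo[%classic t -> (0 <= (expR (- (t * a^-1)) / t)%:E)%E.
  by rewrite /= in_itv/= andbT => t1; rewrite lee_fin divr_ge0 ?expR_ge0//; lra.
have K_ge0 : (0 <= K)%E by exact: integral_ge0.
have KE : (\int[mu]_(t in `[1%R, +oo[) (G t)%:E = (expR a^-1)%:E * K)%E.
  rewrite -ge0_integralZl//; last first.
    apply/measurable_EFinP; apply: subspace_continuous_measurable_fun => //.
    apply: continuous_in_subspaceT => t; rewrite inE/= in_itv/= andbT => t1.
    apply: cvgM; last by apply: cvgV; [rewrite gt_eqF//; lra|exact: cvg_id].
    apply: (@continuous_comp R R R (fun t => - (t * a^-1)) (@expR R));
      last exact: continuous_expR.
    by apply: cvgN; apply: cvgMl; exact: cvg_id.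
  apply: eq_integral => t _; rewrite /G -EFinM mulrA -expRD;
    congr ((expR _ / _)%:E).
  by ring.
(* [E1] is a real-valued integral, equal to 0 by default if the extended one is infinite, so
   finiteness must be proved; it follows from [a / (1 + a u) <= a]. *)
have Koo : (K < +oo)%E.
  have : ((expR a^-1)%:E * K <= a%:E)%E.
    rewrite -KE -subst_G -(integral_cst_expRN (ltW a0));
      apply: ge0_le_integral => //.
    - move=> u; rewrite /= in_itv/= andbT => u0;
        rewrite lee_fin mulr_ge0 ?expR_ge0// divr_ge0 ?(ltW a0)//.
      by have := mulr_ge0 (ltW a0) u0; lra.
    - apply/measurable_EFinP; apply: subspace_continuous_measurable_fun => //.
      move=> u; apply: cvgM; first exact: within_continuous_inv1DM (ltW a0) _.
      exact: (continuous_subspaceT continuous_expRN).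
    - apply/measurable_EFinP; apply: subspace_continuous_measurable_fun => //.
      by apply: continuous_subspaceT => u; apply: cvgMr; exact: continuous_expRN.
    - move=> u; rewrite /= in_itv/= andbT => u0;
        rewrite lee_fin ler_wpM2r ?expR_ge0//.
      have := mulr_ge0 (ltW a0) u0 => au0.
      by rewrite ler_pdivrMr; nra.
  by case: (K) K_ge0 => [r|//|//] _; rewrite ?ltry// gt0_muley ?lte_fin ?expR_gt0.
by rewrite subst_G KE EFinM /E1 /Rintegral fineK// ge0_fin_numE.
Qed.

End exponential_integral.

(** * Image of the area under the squared norm *)

Section radial.
Context {R : realType}.
Implicit Types (u : R) (z : R * R).
Local Notation mu := (@lebesgue_measure R).

Definition sqnorm z : R := z.1 ^+ 2 + z.2 ^+ 2.

Lemma sqnorm_ge0 z : 0 <= sqnorm z.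
Proof. by rewrite addr_ge0// sqr_ge0. Qed.

Lemma measurable_sqnorm : measurable_fun setT sqnorm.
Proof.
by apply: measurable_funD; apply: measurable_funX;
  [exact: measurable_fst|exact: measurable_snd].
Qed.

Lemma measurable_sqnorm_le u : measurable [set z | sqnorm z <= u].
Proof.
rewrite -[X in measurable X]setTI; apply: measurable_fun_le => //.
exact: measurable_sqnorm.
Qed.

(** A disc is the lens with [d = 0], and [acos 0 = pi / 2]. *)
Lemma area_disc u : 0 <= u -> area [set z | sqnorm z <= u] = (pi * u)%:E.
Proof.
rewrite le_eqVlt => /predU1P[<-|u0].
  rewrite mulr0 (_ : [set z | _] = [set 0] `*` [set 0]).
    by rewrite /area product_measure1E//;
      rewrite [X in (X * _)%E]lebesgue_measure_set1 mul0e.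
  apply/seteqP; split=> -[x y] /=; rewrite /sqnorm/=.
    move=> H; have x2 := sqr_ge0 x; have y2 := sqr_ge0 y.
    by split; apply/eqP; rewrite -sqrf_eq0; apply/eqP; lra.
  by move=> [-> ->]; rewrite !expr0n/= addr0.
have su : 0 < Num.sqrt u by rewrite sqrtr_gt0.
have := area_lens (lexx 0) (ltW su) su.
rewrite mul0r acos0 mulr0 mul0r subr0 sqr_sqrtr ?ltW// => H.
transitivity (area (lens 0 (Num.sqrt u))).
  congr (area _); apply/seteqP; split=> z;
    by rewrite /lens/= /sqnorm addr0 real_normK ?num_real// sqr_sqrtr// ltW.
by rewrite H; congr (_%:E); field.
Qed.

(** The area of a disc is linear in its squared radius, so the annulus over []a, b]] has area
    [pi (b - a)] when [0 <= a]; negative values are never reached. *)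
Lemma pushforward_sqnorm (B : set R) : measurable B ->
  area (sqnorm @^-1` B) = (\int[mu]_(u in B) (pi * \1_`[0, +oo[ u)%:E)%E.
Proof.
have ms : measurable_fun setT (sqnorm : R * R -> measurableTypeR R)
  by exact: measurable_sqnorm.
have msV (A : set R) : measurable A -> measurable (sqnorm @^-1` A).
  by move=> mA; rewrite -[X in measurable X]setTI; exact: ms.
pose q : {mfun (R * R)%type >-> measurableTypeR R} :=
  HB.pack (sqnorm : R * R -> measurableTypeR R)
    (isMeasurableFun.Build _ _ _ _ _ ms).
move: B; apply: (@measure_density_ocitv R (pushforward (mu \x mu)%E q)) =>
  [||a b ab|a b].
- apply: measurable_funM => //; exact: measurable_indic.
- by move=> u; rewrite mulr_ge0 ?pi_ge0.
- transitivity (area (sqnorm @^-1` `]a, b])) => //.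
  have [b0|b0] := ltP b 0.
    rewrite (_ : sqnorm @^-1` _ = set0); last first.
      by apply/seteqP; split=> // z; rewrite /= in_itv/= => /andP[_]; have :=
        sqnorm_ge0 z; lra.
    rewrite /area measure0 integral0_eq// => u; rewrite /= in_itv/= =>
      /andP[_ ub].
    by rewrite indicE memNset ?mulr0//= in_itv/= andbT; lra.
  pose D u : set (R * R) := [set z | sqnorm z <= u].
  have Doo : (area (D b) < +oo)%E by rewrite area_disc// ltry.
  transitivity ((pi * (b - Num.max a 0))%:E); last first.
    under eq_integral do rewrite EFinM.
    rewrite ge0_integralZl//; last 2 first.
    - by apply: measurable_funTS; apply/measurable_EFinP; exact: measurable_indic.
    - by rewrite lee_fin pi_ge0.
    rewrite integral_indic// EFinM; congr (_ * _)%E.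
    have [a0|a0] := ltP a 0.
      rewrite (_ : _ `&` _ = `[0, b]%classic); last first.
        by apply/seteqP; split=> u; rewrite /= !in_itv/= andbT;
          [move=> [-> /andP[]]|move=> /andP[? ?]; split=> //; apply/andP;
            split => //; lra].
      transitivity (mu `[0, b]%classic) => //.
      rewrite lebesgue_measure_itv/= lte_fin; case: ifPn => [_|];
        first by rewrite -EFinB.
      by rewrite -leNgt => ?; congr (_%:E); lra.
    rewrite (_ : _ `&` _ = `]a, b]%classic); last first.
      by apply/seteqP; split=> u; rewrite /= !in_itv/= andbT;
        [move=> []|move=> /andP[au ub]; split=> //; [lra|rewrite au]].
    transitivity (mu `]a, b]%classic) => //.
    by rewrite lebesgue_measure_itv/= lte_fin ab -EFinB.
  have [a0|a0] := ltP a 0.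
    rewrite subr0 -area_disc//; congr (area _); apply/seteqP; split => z;
      rewrite /= in_itv/=.
      by case/andP.
    by move=> ->; rewrite andbT; have := sqnorm_ge0 z; lra.
  rewrite (_ : sqnorm @^-1` _ = D b `\` D a); last first.
    apply/seteqP; split => z; rewrite /= in_itv/= /D/=.
      by move=> /andP[az ->]; split => //; apply/negP; rewrite -ltNge.
    by move=> [-> /negP]; rewrite -ltNge => ->.
  rewrite /area measureD//=;
    [|exact: measurable_sqnorm_le|exact: measurable_sqnorm_le].
  rewrite setIidr; last by move=> z; rewrite /D/=; lra.
  by rewrite -/area area_disc// area_disc// -EFinB; congr (_%:E); ring.
- apply: (@le_lt_trans _ _ (area [set z | sqnorm z <= Num.max b 0])).
    apply: (@le_measure _ _ _ (mu \x mu)%E (sqnorm @^-1` `]a, b]%classic));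
      rewrite ?inE; [exact: msV|exact: measurable_sqnorm_le|].
    by move=> z; rewrite /= in_itv/= le_max => /andP[_ ->].
  by rewrite area_disc ?ltry// le_max lexx orbT.
Qed.

End radial.

Section rayleigh.
Context {R : realType}.
Local Notation mu := (@lebesgue_measure R).
Local Notation N := (normal_prob 0 (Num.sqrt 2^-1) :
  probability (measurableTypeR R) R).

Lemma ge0_integral_radial (f : R -> \bar R) :
  measurable_fun setT f -> (forall u, 0 <= f u)%E ->
  (\int[mu \x mu]_z f (sqnorm z) = \int[mu]_u (f u * (pi * \1_`[0, +oo[ u)%:E))%E.
Proof.
move=> mf f0.
have ms : measurable_fun setT (sqnorm : R * R -> measurableTypeR R)
  by exact: measurable_sqnorm.
pose q : {mfun (R * R)%type >-> measurableTypeR R} :=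
  HB.pack (sqnorm : R * R -> measurableTypeR R)
    (isMeasurableFun.Build _ _ _ _ _ ms).
rewrite -(@ge0_integral_density _ _ _ mu (pushforward (mu \x mu)%E q))//.
- by rewrite ge0_integral_pushforward.
- by apply: measurable_funM => //; exact: measurable_indic.
- by move=> u; rewrite mulr_ge0 ?pi_ge0.
- exact: pushforward_sqnorm.
Qed.

Lemma measurable_expRN : measurable_fun setT (fun u : R => expR (- u)).
Proof. by apply: continuous_measurable_fun; exact: continuous_expRN. Qed.

Lemma ge0_integral_normal_pair (f : R * R -> \bar R) :
  measurable_fun setT f -> (forall z, 0 <= f z)%E ->
  (\int[N \x N]_z f z =
   \int[mu \x mu]_z (f z * (pi^-1 * expR (- sqnorm z))%:E))%E.
Proof.
move=> mf f0.
pose n (x : R) : R := normal_pdf 0 (Num.sqrt 2^-1) x.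
have n_ge0 x : 0 <= n x by exact: normal_pdf_ge0.
have mn : measurable_fun setT n by exact: measurable_normal_pdf.
have dens (g : R -> \bar R) : measurable_fun setT g -> (forall x, 0 <= g x)%E ->
    (\int[N]_x g x = \int[mu]_x (g x * (n x)%:E))%E.
  by move=> mg g0; exact: (@ge0_integral_density _ (measurableTypeR R) R mu N n
    mn n_ge0 (fun _ _ => erefl) g).
(* With variance 1/2 the factor 2 of the Gaussian exponent disappears, and the product of two
   densities is radial. *)
have nE x : n x = (Num.sqrt pi)^-1 * expR (- x ^+ 2).
  have s0 : Num.sqrt 2^-1 != 0 :> R by rewrite gt_eqF// sqrtr_gt0 invr_gt0.
  rewrite /n /normal_pdf (negbTE s0) /normal_peak /normal_fun sqr_sqrtr
    ?invr_ge0// subr0.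
  congr ((Num.sqrt _)^-1 * expR _); rewrite -mulr_natr;
    [|rewrite mulVf// divr1//].
  by field.
rewrite fubini_tonelli1// /fubini_F.
transitivity (\int[mu]_x (\int[mu]_y (f (x, y) * (n y)%:E) * (n x)%:E))%E.
  rewrite dens.
  - apply: eq_integral => x _; rewrite dens//; exact: measurableT_comp.
  - exact: measurable_fun_fubini_tonelli_F.
  - by move=> x; exact: integral_ge0.
rewrite fubini_tonelli1//; last 2 first.
- apply: emeasurable_funM => //; apply/measurable_EFinP;
    apply: measurable_funM => //.
  exact: (measurableT_comp measurable_expRN measurable_sqnorm).
- by move=> z; rewrite mule_ge0// lee_fin mulr_ge0 ?invr_ge0 ?pi_ge0 ?expR_ge0.
have mfx x : measurable_fun setT (fun y => f (x, y)) by exact: measurableT_comp.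
have mfn x : measurable_fun setT (fun y : R => (f (x, y) * (n y)%:E)%E).
  by apply: emeasurable_funM => //; exact/measurable_EFinP.
rewrite /fubini_F; apply: eq_integral => x _; rewrite -ge0_integralZr//=.
- apply: eq_integral => y _; rewrite -muleA -EFinM; congr (_ * _%:E)%E.
  rewrite !nE mulrACA -invfM -expr2 sqr_sqrtr ?pi_ge0// -expRD /sqnorm/=.
  by congr (_ * expR _); ring.
- exact: mfn.
- by move=> y _; rewrite mule_ge0// lee_fin.
- by rewrite lee_fin.
Qed.

Lemma ge0_integral_rayleigh (f : R -> \bar R) :
  measurable_fun setT f -> (forall u, 0 <= f u)%E ->
  (\int[N \x N]_z f (sqnorm z) =
    \int[mu]_(u in `[0%R, +oo[) (f u * (expR (- u))%:E))%E.
Proof.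
move=> mf f0; rewrite ge0_integral_normal_pair//; last first.
  by apply: (measurableT_comp mf); exact: measurable_sqnorm.
rewrite (ge0_integral_radial (f := fun u => (f u * (pi^-1 * expR (- u))%:E)%E)).
- rewrite [RHS]integral_mkcond; apply: eq_integral => u _.
  rewrite patchE indicE; case: ifPn => u0;
    rewrite ?mulr0 ?mule0// mulr1 -muleA -EFinM.
  by congr (_ * _%:E)%E; rewrite mulrAC mulVf ?mul1r// gt_eqF ?pi_gt0.
- apply: emeasurable_funM => //; apply/measurable_EFinP;
    apply: measurable_funM => //.
  exact: measurable_expRN.
- by move=> u; rewrite mule_ge0// lee_fin mulr_ge0 ?invr_ge0 ?pi_ge0 ?expR_ge0.
Qed.

End rayleigh.

(** * Conditional expectations *)

Section independence.
Context {dsp : measure_display} {Omega : measurableType dsp} {R : realType}.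
Variable P : probability Omega R.

(** By independence the joint law of [S] and [H] is a product on rectangles, hence everywhere;
    Tonelli's theorem then integrates over the fading with [S] frozen. *)
Lemma ge0_integral_independent (F : set (set Omega)) (H : Omega -> R[i])
  (S : Omega -> R)
    (f : R * (R * R) -> \bar R) :
  F `<=` measurable -> complex_RV H -> independent_of P F H ->
  (forall B, measurable B -> F (S @^-1` B)) ->
  measurable_fun setT f -> (forall x, 0 <= f x)%E ->
  (\int[P]_w f (S w, C_pair (H w)) =
   \int[P]_w \int[P]_w' f (S w, C_pair (H w')))%E.
Proof.
move=> FmO mH indep FS mf f0.
have mS : measurable_fun setT (S : Omega -> measurableTypeR R).
  by move=> _ B mB; rewrite setTI; exact/FmO/FS.
have mSh : measurable_fun setT
  (fun w => (S w, C_pair (H w)) : measurableTypeR R * (R * R)).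
  by apply/measurable_fun_pairP; split.
pose S' : {mfun Omega >-> measurableTypeR R} :=
  HB.pack S (isMeasurableFun.Build _ _ _ _ _ mS).
pose h : {mfun Omega >-> (R * R)%type} :=
  HB.pack (C_pair \o H) (isMeasurableFun.Build _ _ _ _ _ mH).
pose Sh : {mfun Omega >-> (measurableTypeR R * (R * R))%type} :=
  HB.pack (fun w => (S w, C_pair (H w)) : measurableTypeR R * (R * R))
    (isMeasurableFun.Build _ _ _ _ _ mSh).
pose m1 : probability _ R := distribution P S'.
pose m2 : probability _ R := distribution P h.
have prodE X : measurable X -> (m1 \x m2)%E X = pushforward P Sh X.
  move=> mX; apply: (@product_measure_unique _ _ _ _ _ m1 m2 (pushforward P Sh))
    => // A B mA mB.
  exact: indep (FS _ mA) mB.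
transitivity (\int[pushforward P Sh]_x f x)%E.
  by rewrite ge0_integral_pushforward.
transitivity (\int[m1 \x m2]_x f x)%E.
  by apply: eq_measure_integral => X mX _; exact/esym/prodE.
have FE : fubini_F m2 f = (fun s => \int[P]_w' f (s, C_pair (H w')))%E.
  apply/funext => s; rewrite /fubini_F ge0_integral_distribution//.
  exact: measurableT_comp.
have mF := @measurable_fun_fubini_tonelli_F _ _ _ _ R m2 f mf f0.
transitivity (\int[m1]_s fubini_F m2 f s)%E; first exact: fubini_tonelli1.
rewrite ge0_integral_distribution//; last by move=> s; exact: integral_ge0.
by rewrite FE.
Qed.

End independence.

Section sub_sigma_algebra.
Context {dsp : measure_display} {Omega : measurableType dsp} {R : realType}.
Variables (P : probability Omega R) (Gn : set (set Omega)).
Hypothesis GnO : <<s Gn>> `<=` measurable.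
Local Notation TG := (g_sigma_algebraType Gn).

(** Uniqueness of conditional expectations. It is proved on [TG], with [P] carried over by the
    identity, so that the measurable sets are exactly the test events; the bound on [f] supplies
    integrability. *)
Lemma ae_eq_sub_sigma_algebra (D : set TG) (f g : TG -> \bar R) (M : R) :
  measurable D -> measurable_fun D f -> measurable_fun D g ->
  (forall w, D w -> 0 <= f w <= M%:E)%E ->
  (forall A : set Omega, <<s Gn>> A -> A `<=` D ->
    \int[P]_(w in A) g w = \int[P]_(w in A) f w)%E ->
  {ae P, forall w, D w -> g w = f w}.
Proof.
move=> mD mf mg fM gf.
have mid : measurable_fun setT (id : Omega -> TG).
  by move=> _ B mB; rewrite setTI; exact: GnO.
pose i : {mfun Omega >-> TG} :=
  HB.pack (id : Omega -> TG) (isMeasurableFun.Build _ _ _ _ _ mid).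
pose PG : probability TG R := distribution P i.
have intE (u : TG -> \bar R) (A : set TG) : measurable A -> measurable_fun A u ->
    (\int[PG]_(w in A) u w = \int[P]_(w in A) u w)%E.
  move=> mA mu; rewrite integralE [RHS]integralE; congr (_ - _)%E.
    by rewrite (ge0_integral_pushforward mid P)//; exact: measurable_funepos.
  by rewrite (ge0_integral_pushforward mid P)//; exact: measurable_funeneg.
have fi : PG.-integrable D f.
  apply/integrableP; split => //;
    apply: (@le_lt_trans _ _ (\int[PG]_(w in D) `|M|%:E)%E).
    apply: ge0_le_integral => //.
    - exact: measurableT_comp.
    - move=> w Dw; have /andP[f0 fM'] := fM _ Dw; rewrite gee0_abs//.
      by rewrite (le_trans fM')// lee_fin ler_norm.
  rewrite integral_cst//; apply: lte_mul_pinfty => //.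
  apply: (@le_lt_trans _ _ 1%E); last exact: ltry.
  by apply: (@probability_le1 _ _ _ P); exact: GnO.
have [N [mN PN0 DN]] : ae_eq PG D f g.
  apply: integral_ae_eq => // E ED mE.
  rewrite !intE//; [|exact: measurable_funS mg|exact: measurable_funS mf].
  by rewrite gf.
exists N; split => //; first exact: GnO.
by move=> w /= H; apply: DN => /= H'; apply: H => Dw; rewrite H'.
Qed.

End sub_sigma_algebra.

(** Nothing is known of [f] outside the positive reals; composing with [expR] gives a monotone
    function on the whole line, and [ln] undoes the change of variable. *)
Lemma measurable_nonincreasing_gt0 (R : realType) (f : R -> R) :
  (forall x y, 0 < x -> x <= y -> f y <= f x) -> measurable_fun `](0 : R), +oo[ f.
Proof.
move=> f_ni.
have mfe : measurable_fun setT (f \o @expR R).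
  by apply: nonincreasing_measurable => // x y xy /=;
    rewrite f_ni ?expR_gt0// ler_expR.
apply: (eq_measurable_fun ((f \o @expR R) \o @ln R)).
  by move=> x; rewrite inE/= in_itv/= andbT => x0; rewrite lnK.
by apply: measurable_funTS; apply: measurableT_comp => //; exact: measurable_ln.
Qed.

Lemma normc_sqr (R : realType) (z : R[i]) : Normc.normc z ^+ 2 =
  sqnorm (C_pair z).
Proof. by case: z => a b; rewrite /= sqr_sqrtr// addr_ge0// sqr_ge0. Qed.

Section log_rate.
Context {R : realType}.
Variable SNR : R.
Hypothesis SNR_gt0 : 0 < SNR.

Lemma log2_ge0 (x : R) : 1 <= x -> 0 <= log2 x.
Proof. by move=> x1; rewrite /log2 divr_ge0 ?ln_ge0// ler1n. Qed.

Lemma log2_le (x y : R) : 0 < x -> x <= y -> log2 x <= log2 y.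
Proof.
move=> x0 xy; rewrite /log2 ler_wpM2r ?invr_ge0 ?ln_ge0 ?ler1n//.
by rewrite ler_ln ?posrE//; lra.
Qed.

Lemma measurable_log2 : measurable_fun setT (@log2 R).
Proof. by apply: measurable_funM => //; exact: measurable_ln. Qed.

Lemma log_rate_arg_ge1 (z : R * R) s : 0 <= s -> 1 <= 1 + SNR * sqnorm z * s.
Proof. by move=> s0; rewrite lerDl !mulr_ge0 ?sqnorm_ge0// ltW. Qed.

Lemma measurable_log_rate :
  measurable_fun setT (fun x : R * (R * R) =>
    (log2 (1 + SNR * sqnorm x.2 * Num.max x.1 0))%:E).
Proof.
apply/measurable_EFinP; apply: (measurableT_comp measurable_log2).
apply: measurable_funD => //; apply: measurable_funM.
  apply: measurable_funM => //.
  exact: (measurableT_comp measurable_sqnorm measurable_snd).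
by apply: measurable_maxr => //; exact: measurable_fst.
Qed.

End log_rate.

(** * Conditional expected rate of one link *)

Section conditional_rate.
Context {dsp : measure_display} {Omega : measurableType dsp} {R : realType}.
Variables (P : probability Omega R) (Gn : set (set Omega)).
Hypothesis GnO : <<s Gn>> `<=` measurable.
Local Notation TG := (g_sigma_algebraType Gn).
Variables (SNR : R) (G psi : R -> R) (H : Omega -> R[i]).
Hypotheses (SNR_gt0 : 0 < SNR) (G_path_loss : path_loss G).
Hypotheses (mH : complex_RV H) (H_indep : independent_of P <<s Gn>> H).
Hypothesis psiE : forall s : R, 0 <= s ->
  (\int[P]_w (log2 (1 + SNR * Normc.normc (H w) ^+ 2 * s))%:E = (psi s)%:E)%E.

Lemma mean_rate0 : psi 0 = 0.
Proof.
apply/EFin_inj; rewrite -psiE// integral0_eq// => w _.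
by rewrite mulr0 addr0 /log2 ln1 mul0r.
Qed.

Lemma mean_rate_ge0 (s : R) : 0 <= s -> 0 <= psi s.
Proof.
move=> s0; rewrite -lee_fin -psiE//; apply: integral_ge0 => w _.
by rewrite lee_fin log2_ge0// normc_sqr log_rate_arg_ge1.
Qed.

Lemma mean_rate_le (s t : R) : 0 <= s -> s <= t -> psi s <= psi t.
Proof.
move=> s0 st; have t0 : 0 <= t by exact: le_trans st.
have mf (u : R) : 0 <= u ->
  measurable_fun setT (fun w => (log2 (1 + SNR * Normc.normc (H w) ^+ 2 * u))%:E).
  move=> u0; rewrite (_ : (fun w => _) =
    (fun x => (log2 (1 + SNR * sqnorm x.2 * Num.max x.1 0))%:E) \o
    (fun w => (u, C_pair (H w)))); last first.
    by apply/funext => w /=; rewrite normc_sqr (max_idPl u0).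
  apply: measurableT_comp; first exact: measurable_log_rate.
  by apply/measurable_fun_pairP; split; [exact: measurable_cst|exact: mH].
rewrite -lee_fin -!psiE//; apply: ge0_le_integral => //.
- by move=> w _; rewrite lee_fin log2_ge0// normc_sqr log_rate_arg_ge1.
- exact: mf.
- exact: mf.
- move=> w _; rewrite lee_fin normc_sqr log2_le//.
    by rewrite (lt_le_trans ltr01)// log_rate_arg_ge1.
  by rewrite lerD2l ler_wpM2l// mulr_ge0 ?sqnorm_ge0// ltW.
Qed.

Lemma integral_link_rate (A : set Omega) (dist : TG -> R) :
  <<s Gn>> A -> measurable_fun (A : set TG) dist ->
    (forall w, A w -> 0 < dist w) ->
  (\int[P]_(w in A) link_rate SNR G H dist w =
    \int[P]_(w in A) (psi (G (dist w)))%:E)%E.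
Proof.
move=> FA mdist dist_gt0; have [G_ge0 G_ni _] := G_path_loss.
have mA : measurable A by exact: GnO.
(* Off [A], [S] vanishes and so does the rate, which turns the integral over [A]
   into an integral over [Omega]. *)
pose S : TG -> R := (G \o dist) \_ A.
have mS : measurable_fun setT S.
  apply/(measurable_restrictT _ _).1 => //.
  apply: (measurable_comp (F := `](0 : R), +oo[%classic)) mdist => //.
    by move=> _ [w Aw <-]; rewrite /= in_itv/= andbT dist_gt0.
  exact: measurable_nonincreasing_gt0.
have S_ge0 w : 0 <= S w.
  by rewrite /S patchE; case: ifPn => // /set_mem Aw /=; rewrite G_ge0// dist_gt0.
(* The truncation makes [f] nonnegative everywhere, as Tonelli's theorem requires; it does not
   affect the values at [S], which are nonnegative. *)
pose f (x : R * (R * R)) := (log2 (1 + SNR * sqnorm x.2 * Num.max x.1 0))%:E.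
have f_ge0 x : (0 <= f x)%E.
  by rewrite lee_fin log2_ge0// log_rate_arg_ge1// le_max lexx orbT.
have FS (B : set R) : measurable B -> <<s Gn>> (S @^-1` B).
  by move=> mB; rewrite -[S @^-1` B]setTI; exact: mS.
have := ge0_integral_independent GnO mH H_indep FS (measurable_log_rate SNR)
  f_ge0.
rewrite /f /= => fE.
transitivity (\int[P]_w (log2
  (1 + SNR * sqnorm (C_pair (H w)) * Num.max (S w) 0))%:E)%E.
  rewrite integral_mkcond; apply: eq_integral => w _.
  rewrite patchE /S patchE; case: ifPn => wA;
    last by rewrite maxxx mulr0 addr0 /log2 ln1 mul0r.
  have Aw : A w by exact: set_mem.
  by rewrite /link_rate normc_sqr (max_idPl (G_ge0 _ (dist_gt0 _ Aw))).
rewrite fE [RHS]integral_mkcond; apply: eq_integral => w _.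
under eq_integral do rewrite -normc_sqr.
rewrite (max_idPl (S_ge0 w)) psiE// /S !patchE; case: ifPn => // _.
by rewrite mean_rate0.
Qed.

Lemma conditional_rate_ae (D : set Omega) (dist : Omega -> R)
  (C : Omega -> \bar R) :
  <<s Gn>> D -> measurable_fun (D : set TG) dist ->
  cond_exp_on P <<s Gn>> D (link_rate SNR G H dist) C ->
  {ae P, forall w, D w -> 0 < dist w -> C w = (psi (G (dist w)))%:E}.
Proof.
move=> FD mdist [mC CE]; have [G_ge0 G_ni _] := G_path_loss.
pose kappa := psi \o G.
have mkappa : measurable_fun `](0 : R), +oo[ kappa.
  by apply: measurable_nonincreasing_gt0 => x y x0 xy;
    rewrite mean_rate_le ?G_ge0 ?G_ni//; lra.
pose D' := D `&` [set w | 0 < dist w].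
(* The rate is unbounded, possibly not integrable, when the distance tends to 0:
   versions are compared on the events [Dn n], where it is bounded. *)
pose Dn (n : nat) := D' `&` [set w | kappa (dist w) <= n%:R].
have mD' : measurable (D' : set TG).
  rewrite (_ : D' = D `&` dist @^-1` `]0, +oo[); first exact: mdist.
  by apply/seteqP; split=> w [Dw] /=; rewrite in_itv/= andbT.
have mCD : measurable_fun (D : set TG) (C : TG -> \bar R) by move=> _ B mB;
  apply: mC; exists B.
have mdist' : measurable_fun (D' : set TG) dist by apply: measurable_funS mdist
  => // w [].
have mk' : measurable_fun (D' : set TG) (kappa \o dist).
  apply: (measurable_comp (F := `](0 : R), +oo[%classic)) mdist' => //.
  by move=> _ [w [_ dw] <-]; rewrite /= in_itv/= andbT.
have mDn n : measurable (Dn n : set TG).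
  rewrite (_ : Dn n = D' `&` (kappa \o dist) @^-1` `]-oo, n%:R]);
    first exact: mk'.
  by apply/seteqP; split=> w [Dw] /=; rewrite in_itv/=.
have aen n : {ae P, forall w, Dn n w -> C w = (kappa (dist w))%:E}.
  apply: (@ae_eq_sub_sigma_algebra _ _ _ P Gn GnO (Dn n) _ C n%:R) => //.
  - by apply/measurable_EFinP; apply: measurable_funS mk' => // w [].
  - by apply: measurable_funS mCD => // w [[]].
  - move=> w [[Dw dw] kn]; rewrite !lee_fin kn andbT.
    by rewrite mean_rate_ge0// G_ge0.
  - move=> A FA AD; rewrite CE//; last by move=> w /AD[[]].
    apply: integral_link_rate => //; last by move=> w /AD[[]].
    by apply: measurable_funS mdist => // w /AD[[]].
(* The events [Dn n] exhaust [D'], and countably many exceptional null events form a null event. *)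
have := ae_foralln aen; apply: filterS => w Hw Dw dw.
apply: (Hw (Num.truncn (kappa (dist w))).+1); split => //=.
by rewrite ltW// truncnS_gt.
Qed.

End conditional_rate.

(** * The average rate *)

Section average_rate.
Context {dsp : measure_display} {Omega : measurableType dsp} {R : realType}.
Variables (P : probability Omega R) (lambda : R) (Phi : Omega -> set (R * R)).
Hypotheses (lambda_gt0 : 0 < lambda) (PhiPPP : homogeneous_PPP P lambda Phi).
Variables (xs xd : R * R) (d : R).
Hypotheses (d_gt0 : 0 < d) (dist_sd : eucl_dist xs xd = 2 * d).

Let pp : point_process Phi. Proof. by case: PhiPPP. Qed.

(** Used at [xs] and [xd]: both distances of the selected relay are then positive, where [G] is
    constrained. *)
Lemma point_not_in_PPP_ae (x : R * R) : {ae P, forall w, ~ Phi w x}.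
Proof.
have mx : measurable [set x].
  rewrite (_ : [set x] = [set x.1] `*` [set x.2]); first exact: measurableX.
  by apply/seteqP; split=> -[a b] /=; [move=> <-|move=> [-> ->]; case: x].
have bx : bounded_set [set x].
  by exists `|x|; split; [exact: num_real|move=> y /ltW xy _ /= ->].
have area_x : area [set x] = 0%E.
  rewrite (_ : [set x] = [set x.1] `*` [set x.2]).
    by rewrite /area product_measure1E//;
      rewrite [X in (X * _)%E]lebesgue_measure_set1 mul0e.
  by apply/seteqP; split=> -[a b] /=; [move=> <-|move=> [-> ->]; case: x {mx bx}].
have := void_probability lambda_gt0 PhiPPP mx bx.
rewrite area_x mulr0 oppr0 expR0 => P1.
have m0 : measurable (pp_count Phi [set x] @^-1` [set 0%:E]).
  rewrite -[X in measurable X]setTI.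
  by case: pp => _ mP; apply: mP => //; exact: emeasurable_set1.
exists (~` (pp_count Phi [set x] @^-1` [set 0%:E])); split.
- exact: measurableC.
- by rewrite probability_setC// P1 subee.
- move=> w /= /contrapT Pwx /pp_count0 Pw0.
  by have : set0 x by rewrite -Pw0.
Qed.

(** The lower end [d > 0] excludes the default value 0 taken without relays. *)
Lemma feedback_event_preimage T : feedback_event Phi xs xd T =
  Gamma_opt Phi xs xd @^-1` `[d, T].
Proof.
apply/seteqP; split=> w /=; rewrite feedback_eventE// in_itv/=.
  move=> [P0 ->]; rewrite andbT.
  by have [X _ [-> _]] := Gamma_opt_attained xs xd pp P0; exact: shat_ge.
move=> /andP[dG GT]; split=> //; apply/set0P/eqP => /(Gamma_opt_set0 xs xd) G0.
by move: dG; rewrite G0 leNgt d_gt0.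
Qed.

Variables (SNR T : R) (G psi : R -> R) (Hsr Hrd : Omega -> R[i]).
Hypotheses (SNR_gt0 : 0 < SNR) (G_path_loss : path_loss G).
Hypotheses (mHsr : complex_RV Hsr) (mHrd : complex_RV Hrd).
Hypotheses (Hsr_indep : independent_of P (pp_sigma Phi) Hsr).
Hypotheses (Hrd_indep : independent_of P (pp_sigma Phi) Hrd).
Hypothesis psi_srE : forall s : R, 0 <= s ->
  (\int[P]_w (log2 (1 + SNR * Normc.normc (Hsr w) ^+ 2 * s))%:E = (psi s)%:E)%E.
Hypothesis psi_rdE : forall s : R, 0 <= s ->
  (\int[P]_w (log2 (1 + SNR * Normc.normc (Hrd w) ^+ 2 * s))%:E = (psi s)%:E)%E.

Local Notation fb := (feedback_event Phi xs xd T).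

Let FO : pp_sigma Phi `<=` measurable. Proof. exact: pp_sigma_measurable. Qed.

Lemma rate_FB_ae Xstar Csr Crd : selected_relay Phi xs xd T Xstar ->
  cond_exp_on P (pp_sigma Phi) fb
    (link_rate SNR G Hsr (fun w => eucl_dist xs (Xstar w))) Csr ->
  cond_exp_on P (pp_sigma Phi) fb
    (link_rate SNR G Hrd (fun w => eucl_dist (Xstar w) xd)) Crd ->
  {ae P, forall w, fb w ->
    Order.min (Csr w) (Crd w) = (psi (G (Gamma_opt Phi xs xd w)))%:E}.
Proof.
move=> [mX Xmin] Csr_ce Crd_ce; have [G_ge0 G_ni _] := G_path_loss.
have Ffb : pp_sigma Phi fb by exact: pp_sigma_feedback.
pose Gn := \bigcup_(A in measurable) preimage_set_system setT
  (pp_count (R := R) Phi A) measurable.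
have mXstar : measurable_fun (fb : set (g_sigma_algebraType Gn))
    (Xstar : g_sigma_algebraType Gn -> R * R).
  by move=> _ B mB; apply: mX; exists B.
have mds := measurableT_comp (measurable_eucl_dist xs) mXstar.
have mdd : measurable_fun (fb : set (g_sigma_algebraType Gn))
  (fun w => eucl_dist (Xstar w) xd).
  under eq_fun do rewrite eucl_distC.
  exact: (measurableT_comp (measurable_eucl_dist xd) mXstar).
have aes := conditional_rate_ae FO SNR_gt0 G_path_loss mHsr Hsr_indep psi_srE Ffb
  mds Csr_ce.
have aed := conditional_rate_ae FO SNR_gt0 G_path_loss mHrd Hrd_indep psi_rdE Ffb
  mdd Crd_ce.
near=> w => fbw.
have [[PX _] Xm] := Xmin _ fbw.
have dist_gt0 : 0 < eucl_dist xs (Xstar w).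
  rewrite ltNge; apply/negP => /eucl_dist_le0 E.
  have : ~ Phi w xs by near: w; exact: point_not_in_PPP_ae.
  by rewrite E.
have dist_gt0' : 0 < eucl_dist (Xstar w) xd.
  rewrite ltNge; apply/negP => /eucl_dist_le0 E.
  have : ~ Phi w xd by near: w; exact: point_not_in_PPP_ae.
  by rewrite -E.
have -> : Csr w = (psi (G (eucl_dist xs (Xstar w))))%:E by move: fbw dist_gt0;
  near: w.
have -> : Crd w = (psi (G (eucl_dist (Xstar w) xd)))%:E by move: fbw dist_gt0';
  near: w.
have -> : Gamma_opt Phi xs xd w = shat xs xd (Xstar w).
  have P0 : Phi w !=set0 by exists (Xstar w).
  have [X PX' [-> Xmin']] := Gamma_opt_attained xs xd pp P0.
  (* [Xstar] is minimal among the relays that feed back, [X] among all. As [X] is at least as good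
     as [Xstar], it meets the threshold and feeds back too, so the two minima agree. *)
  apply/eqP; rewrite eq_le Xmin'//= Xm//; split => //.
  by apply: le_trans (Xmin' _ PX) _; case: (Xmin _ fbw) => -[].
rewrite -EFin_min; congr (_%:E); rewrite /shat.
have mono x y : 0 < x -> x <= y -> psi (G y) <= psi (G x).
  move=> x0 xy; apply: (mean_rate_le SNR_gt0 mHsr psi_srE); last exact: G_ni.
  by apply: G_ge0; lra.
have [le|lt] := leP (eucl_dist xs (Xstar w)) (eucl_dist (Xstar w) xd).
  by apply/min_idPr/mono.
by apply/min_idPl/mono => //; exact: ltW.
Unshelve. all: by end_near.
Qed.

(** The scale [c] clears a constant denominator of [psi]: it is 1 without fading and [ln 2] for
    Rayleigh fading. *)
Lemma integral_rate_FB RPhi (c : R) : 0 < c ->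
  rate_FB P Phi xs xd T SNR G Hsr Hrd RPhi ->
  (\int[P]_w RPhi w = ((2 * c)^-1)%:E * \int[lebesgue_measure]_(gamma in `[d, T])
     (c * psi (G gamma) * f_Gamma_opt lambda d gamma)%:E)%E.
Proof.
move=> c_gt0 [Xstar [Csr [Crd [sel Csr_ce Crd_ce ->]]]]; have [G_ge0 G_ni _] :=
  G_path_loss.
have mfb : measurable fb by apply: FO; exact: pp_sigma_feedback.
have mG := measurable_Gamma_opt xs xd pp.
have mC C Z : cond_exp_on P (pp_sigma Phi) fb Z C -> measurable_fun fb C.
  by move=> [mC _] _ B mB; apply: FO; apply: mC; exists B.
have mono x y : 0 < x -> x <= y -> psi (G y) <= psi (G x).
  move=> x0 xy; apply: (mean_rate_le SNR_gt0 mHsr psi_srE); last exact: G_ni.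
  by apply: G_ge0; lra.
have mk : measurable_fun `[d, T] (psi \o G).
  apply: (@measurable_funS _ _ _ _ `](0 : R), +oo[%classic) => //.
    by move=> x; rewrite /= !in_itv/= andbT => /andP[dx _]; exact: lt_le_trans dx.
  by apply: measurable_nonincreasing_gt0.
pose h (gamma : R) := (2^-1 * psi (G gamma))%:E.
have mh : measurable_fun `[d, T] h.
  by apply/measurable_EFinP; apply: measurable_funM.
have h_ge0 gamma : d <= gamma -> (0 <= h gamma)%E.
  by move=> dg; rewrite lee_fin mulr_ge0// (mean_rate_ge0 SNR_gt0 psi_srE)//
    G_ge0// (lt_le_trans d_gt0).
rewrite -integral_mkcond.
transitivity (\int[P]_(w in fb) h (Gamma_opt Phi xs xd w))%E.
  apply: ae_eq_integral => //.
  - apply: emeasurable_funM => //; apply: measurable_mine;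
      [exact: mC Csr_ce|exact: mC Crd_ce].
  - rewrite feedback_event_preimage;
      apply: (measurable_comp (F := `[d, T]%classic)) => //.
      by move=> _ [w /= ? <-].
    exact: measurable_funTS.
  - have := rate_FB_ae sel Csr_ce Crd_ce; apply: filterS => w Hw fbw.
    by rewrite /= Hw.
rewrite feedback_event_preimage.
transitivity (\int[pushforward P
  (Gamma_opt Phi xs xd : Omega -> measurableTypeR R)]_(gamma in `[d, T]) h
    gamma)%E.
  rewrite ge0_integral_pushforward//.
  by move=> g; rewrite inE/= in_itv/= => /andP[dg _]; exact: h_ge0.
(* The sign of [h] is controlled only from [d] on, whereas the density formula takes a function
   nonnegative everywhere; restricting [h] to [[d, T]] by 0 repairs this. *)
rewrite integral_mkcond.
rewrite (@ge0_integral_density _ _ _ lebesgue_measure _ (f_Gamma_opt lambda d));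
  last 5 first.
- exact: measurable_f_Gamma_opt.
- by move=> x; exact: f_Gamma_opt_ge0.
- exact: (law_Gamma_opt lambda_gt0 PhiPPP d_gt0 dist_sd).
- exact/(measurable_restrictT _ _).1.
- move=> x; rewrite patchE; case: ifPn => //; rewrite inE/= in_itv/= =>
    /andP[dx _].
  exact: h_ge0.
transitivity (\int[lebesgue_measure]_(gamma in `[d, T])
  (((2 * c)^-1)%:E * (c * psi (G gamma) * f_Gamma_opt lambda d gamma)%:E))%E.
  rewrite [RHS]integral_mkcond; apply: eq_integral => x _; rewrite !patchE.
  case: ifPn => _; last by exact: mul0e.
  by rewrite /h -!EFinM; congr (_%:E); field; rewrite gt_eqF.
rewrite ge0_integralZl//; last by rewrite lee_fin invr_ge0 mulr_ge0 ?ltW.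
- apply/measurable_EFinP; apply: measurable_funM; first exact: measurable_funM.
  by apply: measurable_funTS; exact: measurable_f_Gamma_opt.
- move=> x; rewrite /= in_itv/= => /andP[dx _];
    rewrite lee_fin mulr_ge0 ?f_Gamma_opt_ge0// mulr_ge0 ?(ltW c_gt0)//.
  by rewrite (mean_rate_ge0 SNR_gt0 psi_srE)// G_ge0// (lt_le_trans d_gt0).
Qed.

End average_rate.

(** * Mean rates under the two fading models *)

Lemma mean_log_rate_no_fading (dsp : measure_display) (Omega : measurableType dsp)
    (R : realType) (P : probability Omega R) (H : Omega -> R[i]) (SNR s : R) :
  complex_RV H -> no_fading P H ->
  (\int[P]_w (log2 (1 + SNR * Normc.normc (H w) ^+ 2 * s))%:E =
    (log2 (1 + SNR * s))%:E)%E.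
Proof.
move=> mH nofading.
transitivity (\int[P]_w (log2 (1 + SNR * s))%:E)%E; last first.
  by rewrite integral_cst// [X in (_ * X)%E](@probability_setT _ _ _ P) mule1.
apply: ae_eq_integral => //.
  under eq_fun do rewrite normc_sqr.
  apply/measurable_EFinP; apply: (measurableT_comp measurable_log2).
  apply: measurable_funD => //; apply: measurable_funM => //;
    apply: measurable_funM => //.
  exact: (measurableT_comp measurable_sqnorm mH).
by apply: filterS nofading => w H1 _; rewrite H1 mulr1.
Qed.

Lemma mean_log_rate_Rayleigh (dsp : measure_display) (Omega : measurableType dsp)
    (R : realType) (P : probability Omega R) (H : Omega -> R[i]) (SNR s : R) :
  0 < SNR -> 0 <= s -> complex_RV H -> Rayleigh_fading P H ->
  (\int[P]_w (log2 (1 + SNR * Normc.normc (H w) ^+ 2 * s))%:E =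
    (expE1 (SNR * s) / ln 2)%:E)%E.
Proof.
move=> SNR_gt0 s_ge0 mH rayleigh.
have ln2_gt0 : 0 < ln 2 :> R by rewrite ln_gt0// ltr1n.
pose f (u : R) := (log2 (1 + SNR * s * Num.max u 0))%:E.
have mf : measurable_fun setT f.
  apply/measurable_EFinP; apply: (measurableT_comp measurable_log2).
  apply: measurable_funD => //; apply: measurable_funM => //.
  exact: measurable_maxr.
have f_ge0 u : (0 <= f u)%E.
  by rewrite lee_fin log2_ge0// lerDl !mulr_ge0 ?(ltW SNR_gt0)// le_max lexx orbT.
transitivity (\int[P]_w f (sqnorm (C_pair (H w))))%E.
  apply: eq_integral => w _; rewrite /f normc_sqr (max_idPl (sqnorm_ge0 _)).
  by congr (log2 (1 + _))%:E; ring.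
have mfs : measurable_fun setT (f \o @sqnorm R).
  exact: (measurableT_comp mf measurable_sqnorm).
have mh : measurable_fun setT
  (C_pair \o H : Omega -> measurableTypeR R * measurableTypeR R).
  exact: mH.
pose h : {mfun Omega >-> (measurableTypeR R * measurableTypeR R)%type} :=
  HB.pack (C_pair \o H : Omega -> measurableTypeR R * measurableTypeR R)
    (isMeasurableFun.Build _ _ _ _ _ mh).
transitivity (\int[pushforward P h]_z f (sqnorm z))%E.
  by rewrite ge0_integral_pushforward.
pose N : probability (measurableTypeR R) R := normal_prob 0 (Num.sqrt 2^-1).
transitivity (\int[N \x N]_z f (sqnorm z))%E.
  by apply: eq_measure_integral => B mB _; exact: rayleigh.
rewrite ge0_integral_rayleigh//.
transitivity (\int[lebesgue_measure]_(u in `[0%R, +oo[)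
    ((ln 2)^-1%:E * (ln (1 + SNR * s * u) * expR (- u))%:E))%E.
  apply: eq_integral => u; rewrite inE/= in_itv/= andbT => u0.
  rewrite /f (max_idPl u0) -!EFinM /log2; congr (_%:E); field.
  by rewrite gt_eqF.
have s0 : 0 <= SNR * s by rewrite mulr_ge0// ltW.
rewrite ge0_integralZl//; last 3 first.
- apply: measurable_funTS; apply/measurable_EFinP; apply: measurable_funM.
    apply: (measurableT_comp (@measurable_ln R)).
    by apply: measurable_funD => //; exact: measurable_funM.
  exact: measurable_expRN.
- move=> u; rewrite /= in_itv/= andbT => u0; rewrite lee_fin mulr_ge0 ?expR_ge0//.
  by rewrite ln_ge0// lerDl mulr_ge0.
- by rewrite lee_fin invr_ge0 ltW.
(* The case [s = 0] occurs where [G] vanishes: the integrand is 0, in agreement with the limit value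
   built into [expE1]. *)
rewrite /expE1; have [SNRs0|SNRs0] := eqVneq (SNR * s) 0.
  rewrite SNRs0 mul0r integral0_eq ?mule0// => u _.
  by rewrite mul0r addr0 ln1 mul0r.
rewrite integral_ln1DM_E1 ?lt0r ?SNRs0//.
by rewrite -EFinM mulrC.
Qed.

Theorem theorem6 (R : realType) (dsp : measure_display)
  (Omega : measurableType dsp) (P : probability Omega R)
  (lambda : R) (lambda_gt0 : 0 < lambda)
  (Phi : Omega -> set (R * R)) (PhiPPP : homogeneous_PPP P lambda Phi)
  (xs xd : R * R) (d : R) (d_gt0 : 0 < d) (dist_sd : eucl_dist xs xd = 2 * d)
  (SNR : R) (SNR_gt0 : 0 < SNR)
  (G : R -> R) (G_path_loss : path_loss G)
  (Hsr Hrd : Omega -> R[i]) (mHsr : complex_RV Hsr) (mHrd : complex_RV Hrd)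
  (H_id : identically_distributed P Hsr Hrd)
  (Hsr_indep : independent_of P (pp_sigma Phi) Hsr)
  (Hrd_indep : independent_of P (pp_sigma Phi) Hrd)
  (T : R) (d_le_T : d <= T)
  (RPhi : Omega -> \bar R)
  (RPhi_rate : rate_FB P Phi xs xd T SNR G Hsr Hrd RPhi) :
  [/\ no_fading P Hsr -> no_fading P Hrd ->
        (\int[P]_w RPhi w =
         (2^-1)%:E * \int[lebesgue_measure]_(gamma in `[d, T])
           (log2 (1 + SNR * G gamma) * f_Gamma_opt lambda d gamma)%:E)%E,
      Rayleigh_fading P Hsr -> Rayleigh_fading P Hrd ->
        (\int[P]_w RPhi w =
         ((2 * ln 2)^-1)%:E * \int[lebesgue_measure]_(gamma in `[d, T])
           (expE1 (SNR * G gamma) * f_Gamma_opt lambda d gamma)%:E)%E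
    & forall B : set R, measurable B ->
        P (Gamma_opt Phi xs xd @^-1` B) =
        (\int[lebesgue_measure]_(gamma in B)
           (f_Gamma_opt lambda d gamma)%:E)%E].
Proof.
have main := integral_rate_FB lambda_gt0 PhiPPP d_gt0 dist_sd SNR_gt0 G_path_loss
  mHsr mHrd Hsr_indep Hrd_indep.
split.
- move=> nf_sr nf_rd.
  rewrite (main T (fun s => log2 (1 + SNR * s))
    (fun s _ => mean_log_rate_no_fading SNR s mHsr nf_sr)
    (fun s _ => mean_log_rate_no_fading SNR s mHrd nf_rd) RPhi 1 ltr01 RPhi_rate).
  by rewrite mulr1; congr (_ * _)%E; apply: eq_integral => gamma _; rewrite mul1r.
- move=> ray_sr ray_rd.
  have ln2_gt0 : 0 < ln 2 :> R by rewrite ln_gt0// ltr1n.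
  rewrite (main T (fun s => expE1 (SNR * s) / ln 2)
    (fun s s_ge0 => mean_log_rate_Rayleigh SNR_gt0 s_ge0 mHsr ray_sr)
    (fun s s_ge0 => mean_log_rate_Rayleigh SNR_gt0 s_ge0 mHrd ray_rd) RPhi (ln 2)
      ln2_gt0 RPhi_rate).
  congr (_ * _)%E; apply: eq_integral => gamma _.
  by congr ((_ * _)%:E); rewrite mulrC divfK// gt_eqF.
- exact: (law_Gamma_opt lambda_gt0 PhiPPP d_gt0 dist_sd).
Qed.
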